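(* Let $\mu=\bigotimes_{k=1}^n\mu_k$ be an unconditional product measure with decreasing density on $\mathbb{R}^n$, and let $A,B\subset\mathbb{R}^n_+$ be anti-blocking bodies. Then for any proper coordinate subspace $E$ of dimension $i$ (with $\mu_E(P_EA),\mu_E(P_EB)>0$), $$\frac{\mu(A)}{\mu_E(P_EA)}+\frac{\mu(B)}{\mu_E(P_EB)}\le r_{n,i}\,\frac{\mu(A-B)}{\mu_E(P_E(A-B))},$$ where $$r_{n,i}:=\max_j\frac{\binom{i}{i+j-n}\binom{j}{i+j-n}}{\binom{n}{i+j-n}},$$ the maximum being over all integers $0\le j\le n$ with $i+j-n\ge0$.
   Context: $\mathbb{R}^n_+=[0,\infty)^n$. A convex body is a nonempty compact convex set. A coordinate subspace is one spanned by a subset of the standard basis $e_1,\dots,e_n$. A convex body $K\subset\mathbb{R}^n_+$ is anti-blocking if $P_EK=K\cap E$ for every coordinate subspace $E$, where $P_E$ is the orthogonal projection onto $E$. $A-B=\{a-b:a\in A,b\in B\}$. An unconditional product measure with decreasing density is $\mu=\bigotimes_{k=1}^n\mu_k$, where each $\mu_k$ is a Borel measure on $\mathbb{R}$ with locally integrable density $\phi_k\ge0$ that is even and non-increasing on $[0,\infty)$; thus the density $\phi(x)=\prod_k\phi_k(x_k)$ of $\mu$ is invariant under sign changes of coordinates and non-increasing on $[0,\infty)$ in each coordinate. For a coordinate subspace $E=\operatorname{span}\{e_k:k\in I\}$, $\mu_E=\bigotimes_{k\in I}\mu_k$ is the corresponding measure on $E$ (with $\mu_E(\{0\})=1$ if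 $E=\{0\}$). *)

(* Defs.v *)
From HB Require Import structures.
From mathcomp Require Import all_boot all_order all_algebra.
From mathcomp Require Import all_classical all_reals all_analysis.
Import Order.TTheory GRing.Theory Num.Theory.
Import numFieldNormedType.Exports.

Set Implicit Arguments.
Unset Strict Implicit.
Unset Printing Implicit Defensive.

Local Open Scope classical_set_scope.
Local Open Scope ring_scope.

Section Euclidean.
Context {R : realType} {n : nat}.

Definition basis_vec (k : 'I_n) : 'rV[R]_n := delta_mx 0 k.

Definition coord_subspace (I : {set 'I_n}) : {vspace 'rV[R]_n} :=
  (<<[seq basis_vec k | k <- enum I]>>)%VS.

(* The formula for the orthogonal projection onto [coord_subspace I] in the
   orthonormal basis [basis_vec k]; see [coord_proj_in] and [coord_proj_orth]. *)
Definition coord_proj (I : {set 'I_n}) (x : 'rV[R]_n) : 'rV[R]_n :=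
  \sum_(k in I) x 0 k *: basis_vec k.

Definition orthant : set 'rV[R]_n := [set x | forall k, 0 <= x 0 k].

Definition convex_body (K : set 'rV[R]_n) : Prop :=
  [/\ K !=set0, compact K & convex_set (K : set (convex_lmodType 'rV[R]_n))].

Definition anti_blocking (K : set 'rV[R]_n) : Prop :=
  [/\ convex_body K, K `<=` orthant &
    forall I : {set 'I_n},
      coord_proj I @` K = K `&` [set x | x \in coord_subspace I]].

Definition set_sub (A B : set 'rV[R]_n) : set 'rV[R]_n :=
  [set x | exists a b, [/\ A a, B b & x = a - b]].

Lemma coord_proj_in (I : {set 'I_n}) (x : 'rV[R]_n) :
  coord_proj I x \in coord_subspace I.
Proof.
apply: memv_suml => k kI; apply/memvZ/memv_span/mapP.
by exists k; rewrite // mem_enum.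
Qed.

Lemma coord_subspaceP (I : {set 'I_n}) (x : 'rV[R]_n) :
  reflect (forall k, k \notin I -> x 0 k = 0) (x \in coord_subspace I).
Proof.
apply: (iffP idP) => [|x0].
  move=> /(@coord_span _ _ _ (in_tuple _)) -> k kI.
  rewrite summxE big1// => j _; rewrite mxE.
  have : (in_tuple [seq basis_vec k0 | k0 <- enum I])`_j \in
         [seq basis_vec k0 | k0 <- enum I] by rewrite mem_nth.
  case/mapP => l; rewrite mem_enum => lI ->.
  rewrite mxE eqxx/=; case: eqP => [kl|]; last by rewrite mulr0.
  by rewrite kl lI in kI.
suff -> : x = coord_proj I x by exact: coord_proj_in.
rewrite {1}(row_sum_delta x) (bigID (mem I))/= [X in _ + X]big1 ?addr0//.
by move=> k kI; rewrite x0// scale0r.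
Qed.

Lemma coord_proj_orth (I : {set 'I_n}) (x y : 'rV[R]_n) :
  y \in coord_subspace I -> (x - coord_proj I x) *m y^T = 0.
Proof.
move=> /coord_subspaceP yI; apply/matrixP => a b; rewrite !ord1 !mxE big1//.
move=> k _; rewrite 3!mxE.
have [kI|kI] := boolP (k \in I); last by rewrite yI ?mulr0.
rewrite summxE (bigD1 k)//= !mxE !eqxx/= mulr1 big1 ?addr0 ?subrr ?mul0r//.
by move=> l /andP[_ lk]; rewrite !mxE eq_sym (negbTE lk) andbF mulr0.
Qed.

End Euclidean.

Section Measures.
Context {R : realType}.
Local Notation RB := (measurableTypeR R).

(* [m] has an even density that is non-increasing on the nonnegative half-line
   and locally integrable. The density takes values in [0, +oo], so that it may
   have a pole at the origin; real-valued densities are a special case. *)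
Definition even_decreasing_density (m : set RB -> \bar R) : Prop :=
  exists phi : R -> \bar R,
  [/\ forall x, (0 <= phi x)%E,
      forall K, compact K -> lebesgue_measure.-integrable K phi,
      forall x, phi (- x) = phi x,
      forall x y, 0 <= x -> x <= y -> (phi y <= phi x)%E
    & forall S : set RB, measurable S ->
        m S = (\int[lebesgue_measure]_(x in S) phi x)%E].

Definition cons_pair n (p : RB * n.-tuple RB) : n.+1.-tuple RB :=
  [tuple of p.1 :: p.2].

(* The product of a finite family of measures; the empty product is the Dirac
   mass on the one-point space. See [prod_measureE]. *)
Fixpoint prod_measure n : ('I_n -> set RB -> \bar R) ->
    set (n.-tuple RB) -> \bar R :=
  match n with
  | 0 => fun _ => dirac [tuple]
  | n'.+1 => fun m =>
      pushforward (m ord0 \x prod_measure (fun j => m (lift ord0 j)))%E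
        (@cons_pair n')
  end.

Definition row_of_tuple n (t : n.-tuple RB) : 'rV[R]_n := \row_j tnth t j.

Definition space_measure n (m : 'I_n -> set RB -> \bar R)
    (S : set 'rV[R]_n) : \bar R :=
  prod_measure m (@row_of_tuple n @^-1` S).

(* The isomorphism of the product of the coordinate lines in [I], listed in
   increasing order, with [coord_subspace I]. *)
Definition subspace_point n (I : {set 'I_n}) (t : #|I|.-tuple RB) : 'rV[R]_n :=
  \sum_(j < #|I|) (tnth t j : R) *: basis_vec (enum_val j).

Definition subspace_measure n (m : 'I_n -> set RB -> \bar R) (I : {set 'I_n})
    (S : set 'rV[R]_n) : \bar R :=
  prod_measure (fun j : 'I_#|I| => m (enum_val j)) (@subspace_point n I @^-1` S).

End Measures.

(* All terms are positive and j = n is admissible, so the default value 0 of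
   the iterated maximum is never attained. *)
Definition rconst (R : realType) (n i : nat) : R :=
  \big[Num.max/0]_(j < n.+1 | (n <= i + j)%N)
    ('C(i, i + j - n)%:R * 'C(j, i + j - n)%:R / 'C(n, i + j - n)%:R).

Section ProductMeasure.
Context {R : realType}.
Local Notation RB := (measurableTypeR R).

Lemma measurable_cons_pair n : measurable_fun setT (@cons_pair R n).
Proof. by apply: measurable_cons. Qed.

Let uncons n (t : n.+1.-tuple RB) : RB * n.-tuple RB :=
  (thead t, [tuple of behead t]).

Let measurable_uncons n : measurable_fun setT (@uncons n).
Proof.
by apply/measurable_fun_pairP; split;
  [exact: measurable_tnth|exact: measurable_behead].
Qed.

Let uncons_cons n (p : RB * n.-tuple RB) : uncons (cons_pair p) = p.
Proof. by case: p => x t; congr (_, _); exact/val_inj. Qed.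

Lemma prod_measure_cons_sigma_finite n
    (m : {sigma_finite_measure set RB -> \bar R})
    (P : {sigma_finite_measure set (n.-tuple RB) -> \bar R}) :
  exists Q : {sigma_finite_measure set (n.+1.-tuple RB) -> \bar R},
    pushforward (m \x P)%E (@cons_pair R n) = Q :> (set _ -> _).
Proof.
pose N : {measure set (RB * n.-tuple RB)%type -> \bar R} := (m \x P)%E.
pose M := measure_function_pushforward__canonical__measure_function_Measure
  N (@measurable_cons_pair n).
have sM : sigma_finite setT M.
  have [[F TF Foo]] := 
    lebesgue_integral_fubini.measure_function_Measure_isSigmaFinite__to__measure_function_isSigmaFinite
      m P.
  exists (fun k => @uncons n @^-1` F k).
    by rewrite -preimage_bigcup -TF preimage_setT.
  move=> k; have [mF Fk] := Foo k; split.
    by rewrite -[X in measurable X]setTI; exact: measurable_uncons.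
  rewrite /M /= /pushforward -comp_preimage (_ : _ \o _ = id)//.
  by apply/funext => p /=; rewrite uncons_cons.
pose Q : {sigma_finite_measure set (n.+1.-tuple RB) -> \bar R} :=
  HB.pack (Measure.sort M) (Measure.class M)
    (Measure_isSigmaFinite.Build _ _ _ _ sM).
by exists Q.
Qed.

Lemma prod_measure_sigma_finite n
    (m : 'I_n -> {sigma_finite_measure set RB -> \bar R}) :
  exists P : {sigma_finite_measure set (n.-tuple RB) -> \bar R},
    prod_measure m = P :> (set _ -> _).
Proof.
elim: n m => [|n IH] m; first by eexists.
have [P /= ->] := IH (fun j => m (lift ord0 j)).
exact: prod_measure_cons_sigma_finite.
Qed.

Lemma prod_measureE n
    (m : 'I_n -> {sigma_finite_measure set RB -> \bar R})
    (S : 'I_n -> set RB) : (forall j, measurable (S j)) ->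
  prod_measure m [set t | forall j, S j (tnth t j)] =
  (\prod_(j < n) m j (S j))%E.
Proof.
elim: n m S => [|n IH] m S mS /=.
  by rewrite big_ord0 /dirac indicE mem_set// => -[].
rewrite big_ord_recl -(IH _ (fun j => S (lift ord0 j)))//.
have [P /= PE] := prod_measure_sigma_finite (fun j => m (lift ord0 j)).
rewrite PE -product_measure1E//; last first.
  rewrite (_ : [set _ | _] =
    \big[setI/setT]_(j < n) ((@tnth n RB ^~ j) @^-1` S (lift ord0 j))).
    apply: bigsetI_measurable => j _.
    by rewrite -[X in measurable X]setTI; exact: measurable_tnth.
  apply/seteqP; split => t; rewrite -bigcap_seq/= => H j; first by move=> _; exact: H.
  by apply: (H j); rewrite /= mem_index_enum.
rewrite /pushforward; congr (_ _); apply/seteqP; split => -[x t]/=.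
  by move=> H; split => [|j]; [exact: (H ord0)|have := H (lift ord0 j); rewrite tnthS].
by move=> [H0 HS] j; case: (unliftP ord0 j) => [k|] ->; rewrite ?tnthS.
Qed.

End ProductMeasure.

(* Main.v *)
(* For J a set of coordinates, let a_J and b_J be the measures of the sections
   of A and B by the coordinate subspace of J. Since A and B are down-closed,
   a point lies in A - B iff its positive part lies in A and its negative part
   in B, so that mu(A - B) is the sum over all J of a_J b_{J^c}, and similarly
   in the subspace E of I. It remains to show
     a_[n] a_J <= r a_I a_{J u I^c}  for J in I,
   and symmetrically for B: the products a_{J u I^c} b_{I \ J} and
   a_J b_{(I \ J) u I^c} are distinct summands of mu(A - B), as I is proper.

   This inequality is proved for disjoint X, Y, Z in the form
     a_{XYZ} a_X <= C a_{XY} a_{XZ}.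
   The fibre of A over a point x of X is contained in the product of its
   projections to Y and Z, hence a_{XYZ} is at most the integral over X of the
   product of the fibre measures g(x) over Y and h(x) over Z. Intervals [0, c]
   have measure concave in c, so the Brunn--Minkowski inequality holds for
   down-closed sets, g^(1/|Y|) and h^(1/|Z|) are concave, and their superlevel
   sets are governed by Brunn--Minkowski over X. Replacing g and h by their
   decreasing rearrangements and comparing the latter with powers of
   1 - (t / a_X)^(1/|X|), Chebyshev's integral inequality yields the constant C
   as a quotient of beta integrals; C is one of the terms of r_{n,i}. *)

Require Import Defs.
From HB Require Import structures.
From mathcomp Require Import all_boot all_order all_algebra.
From mathcomp Require Import all_classical all_reals all_analysis.
From mathcomp Require Import measurable_realfun.
From mathcomp Require Import ring.
Import Order.TTheory GRing.Theory Num.Theory.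
Import numFieldNormedType.Exports.

Set Implicit Arguments.
Unset Strict Implicit.
Unset Printing Implicit Defensive.

Local Open Scope classical_set_scope.
Local Open Scope ring_scope.

(** * Rearrangements and Berwald's inequality *)

Section LayerCake.
Context {R : realType} {d} {T : measurableType d}.
Local Notation RB := (measurableTypeR R).
Local Notation leb := (@lebesgue_measure R).
Local Open Scope ereal_scope.

(** Apart from sigma-finiteness and reflection symmetry, the latter serving only the decomposition
    into orthants, a coordinate measure enters through [concave_distribution]. Such measures are not
    homogeneous, so the Brunn--Minkowski inequality cannot be reached by rescaling the sets. It is
    proved coordinate by coordinate: fibre volumes of a down-closed set are largest at 0, and after
    division by these maxima the level sets of both functions are nonempty at the same heights,
    where intervals [0, c] can replace them. For the origin of C, put T(t) = 1 - (t / V)^(1/k) with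
    V = a_X and k = |X|. The rearrangement of g divided by T^|Y| is nondecreasing, that of h is
    nonincreasing; Chebyshev's inequality needs this opposite monotonicity, first with weight T^|Y|,
    then with weight T^|Z| for h against T^|Y|. As T^p has integral V k! p! / (k + p)!, C is binom(k
    + |Y|, k) binom(k + |Z|, k) / binom(k + |Y| + |Z|, k). Since X runs through all subsets J of I,
    k is not determined by n and i, which is why r_{n,i} is a maximum. *)

Definition level (f : T -> \bar R) (s : R) : set T :=
  [set x | (0 < s)%R /\ s%:E <= f x].

Lemma measurable_hypograph (f : T -> \bar R) : measurable_fun setT f ->
  measurable [set p : T * RB | (0 < p.2)%R /\ p.2%:E <= f p.1].
Proof.
move=> mf.
rewrite (_ : [set _ | _] = [set p : T * RB | (0 < p.2)%R] `&`
   [set p : T * RB | p.2%:E <= f p.1]); last by [].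
apply: measurableI.
  rewrite (_ : [set _ | _] = snd @^-1` `]0%R, +oo[%classic).
    by rewrite -[X in measurable X]setTI; apply: measurable_snd.
  by apply/seteqP; split => p /=; rewrite in_itv/= andbT.
rewrite -[X in measurable X]setTI; apply: measurable_lee => //.
- by apply/measurable_EFinP; exact: measurable_snd.
- by apply: measurableT_comp => //; exact: measurable_fst.
Qed.

Lemma ysection_level (f : T -> \bar R) s :
  ysection [set p : T * RB | (0 < p.2)%R /\ p.2%:E <= f p.1] s = level f s.
Proof. by apply/seteqP; split => x; rewrite /ysection/= inE. Qed.

Lemma xsection_level (f : T -> \bar R) x :
  xsection [set p : T * RB | (0 < p.2)%R /\ p.2%:E <= f p.1] x =
  [set s : RB | (0 < s)%R /\ s%:E <= f x].
Proof. by apply/seteqP; split => s; rewrite /xsection/= inE. Qed.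

Lemma measurable_level (f : T -> \bar R) s : measurable_fun setT f ->
  measurable (level f s).
Proof.
by move=> mf; rewrite -ysection_level; apply: measurable_ysection; exact: measurable_hypograph.
Qed.

Lemma lebesgue_Ioc0 (y : \bar R) : 0 <= y ->
  leb [set s : R | (0 < s)%R /\ s%:E <= y] = y.
Proof.
case: y => [r| |]//; last first.
  move=> _; rewrite (_ : [set _ | _] = `]0%R, +oo[%classic).
    by rewrite lebesgue_measure_itv/= ltry.
  by apply/seteqP; split => s /=; rewrite in_itv/= andbT ?leey//; case.
rewrite lee_fin => r0.
rewrite (_ : [set _ | _] = `]0%R, r]%classic).
  rewrite lebesgue_measure_itv/= lte_fin; case: ltP => [|r0']; rewrite ?sube0//.
  by congr EFin; apply/le_anti; rewrite r0.
by apply/seteqP; split => s /=; rewrite in_itv/= lee_fin => /andP.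
Qed.

Variable P : {sigma_finite_measure set T -> \bar R}.

(** Tonelli's theorem on the hypograph of [f]. Taking for [b] the derivative of a power gives
    integrals of powers of [f], as in [integral_tent]; the weight [w] gives integrals of products,
    as in [layer_cake]. *)
Lemma layer_cake_weighted (f w : T -> \bar R) (b : RB -> \bar R) :
  measurable_fun setT f -> measurable_fun setT w -> measurable_fun setT b ->
  (forall x, 0 <= f x) -> (forall x, 0 <= w x) -> (forall s, 0 <= b s) ->
  \int[P]_x (w x *
    \int[leb]_(s in [set s : R | (0 < s)%R /\ s%:E <= f x]) b s) =
  \int[leb]_s (b s * \int[P]_(x in level f s) w x).
Proof.
move=> mf mw mb f0 w0 b0.
pose E := [set p : T * RB | (0 < p.2)%R /\ p.2%:E <= f p.1].
have mE : measurable E by exact: measurable_hypograph.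
have mE1 : measurable_fun setT (fun p => (\1_E p)%:E : \bar R).
  by apply/measurable_EFinP; exact: measurable_indic.
pose h (p : T * RB) := w p.1 * (b p.2 * (\1_E p)%:E).
have mh : measurable_fun setT h.
  apply: emeasurable_funM; first by apply: measurableT_comp => //; exact: measurable_fst.
  apply: emeasurable_funM => //.
  by apply: measurableT_comp => //; exact: measurable_snd.
have h0 p : 0 <= h p by rewrite !mule_ge0// lee_fin.
transitivity (\int[P]_x \int[leb]_s h (x, s)).
  apply: eq_integral => x _; rewrite /h/=.
  rewrite ge0_integralZl//; last 2 first.
  - apply: emeasurable_funM => //.
    by apply: (measurableT_comp mE1); exact: pair1_measurable.
  - by move=> s _; rewrite mule_ge0// lee_fin.
  congr (_ * _); rewrite [LHS]integral_mkcond; apply: eq_integral => s _.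
  rewrite patchE indicE; case: ifPn => [/set_mem|/negP] sE.
    by rewrite mem_set ?mule1.
  by rewrite memNset ?mule0// => sE'; apply: sE; rewrite inE.
rewrite (@fubini_tonelli _ _ _ _ _ P leb h)//.
apply: eq_integral => s _ /=; rewrite /h/=.
transitivity (\int[P]_x (b s * (w x * (\1_E (x, s))%:E))).
  by apply: eq_integral => x _; rewrite muleCA.
rewrite ge0_integralZl//; last 2 first.
- apply: emeasurable_funM => //.
  by apply: (measurableT_comp mE1); exact: pair2_measurable.
- by move=> x _; rewrite mule_ge0// lee_fin.
congr (_ * _); rewrite [RHS]integral_mkcond; apply: eq_integral => x _.
rewrite patchE indicE; case: ifPn => [/set_mem|/negP] sE.
  by rewrite mem_set ?mule1.
by rewrite memNset ?mule0// => sE'; apply: sE; rewrite inE.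
Qed.

Lemma layer_cake (f w : T -> \bar R) :
  measurable_fun setT f -> measurable_fun setT w ->
  (forall x, 0 <= f x) -> (forall x, 0 <= w x) ->
  \int[P]_x (w x * f x) = \int[leb]_s \int[P]_(x in level f s) w x.
Proof.
move=> mf mw f0 w0.
have := @layer_cake_weighted f w (cst 1) mf mw (@measurable_cst _ _ _ _ _ _) f0 w0 (fun=> lee01).
under [in RHS]eq_integral do rewrite mul1e.
move=> <-; apply: eq_integral => x _; rewrite integral_cst; last first.
  by rewrite -xsection_level; apply: measurable_xsection; exact: measurable_hypograph.
by rewrite mul1e [X in _ = _ * X]lebesgue_Ioc0.
Qed.

(** As [level] asks for a positive height, [distrib] vanishes on the nonpositive reals. Integrals
    over the whole line thus run over positive heights only, and the construction can be applied to
    its own result. *)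
Definition distrib (f : T -> \bar R) (s : R) : \bar R := P (level f s).

Lemma measurable_distrib (f : T -> \bar R) : measurable_fun setT f ->
  measurable_fun (setT : set RB) (distrib f).
Proof.
move=> mf; have := measurable_fun_ysection P (measurable_hypograph mf).
rewrite (_ : _ \o _ = distrib f)//.
by apply/funext => s; rewrite /distrib -ysection_level.
Qed.

Lemma integral_distrib (f : T -> \bar R) :
  measurable_fun setT f -> (forall x, 0 <= f x) ->
  \int[P]_x f x = \int[leb]_s distrib f s.
Proof.
move=> mf f0.
have := @layer_cake f (cst 1) mf (@measurable_cst _ _ _ _ _ _) f0 (fun=> lee01).
under eq_integral do rewrite mul1e.
move=> ->; apply: eq_integral => s _; rewrite integral_cst ?mul1e//.
exact: measurable_level.
Qed.

Lemma distrib_ge0 (f : T -> \bar R) s : 0 <= distrib f s.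
Proof. exact: measure_ge0. Qed.

End LayerCake.

Section Rearrangement.
Context {R : realType} {d} {T : measurableType d}.
Local Notation RB := (measurableTypeR R).
Local Notation leb := (@lebesgue_measure R).
Variable P : {sigma_finite_measure set T -> \bar R}.
Local Open Scope ereal_scope.

(* The decreasing rearrangement is the generalized inverse of the distribution
   function, i.e. the distribution function of the latter. *)
Definition rearr (f : T -> \bar R) : RB -> \bar R :=
  distrib leb (distrib P f : RB -> \bar R).

Lemma measurable_rearr f : measurable_fun setT f ->
  measurable_fun setT (rearr f).
Proof. by move=> mf; do 2 apply: measurable_distrib. Qed.

Lemma integral_rearr f : measurable_fun setT f -> (forall x, 0 <= f x) ->
  \int[leb]_s rearr f s = \int[P]_x f x.
Proof.
move=> mf f0; rewrite (integral_distrib P mf)// /rearr -integral_distrib//.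
exact: measurable_distrib.
Qed.

(** The Hardy--Littlewood inequality: by layer cake the left side integrates, over pairs of heights,
    the measure of the intersection of two level sets, and the right side the minimum of their
    measures. *)
Lemma integral_mul_le_rearr f g :
  measurable_fun setT f -> measurable_fun setT g ->
  (forall x, 0 <= f x) -> (forall x, 0 <= g x) ->
  \int[P]_x (f x * g x) <= \int[leb]_s (rearr f s * rearr g s).
Proof.
move=> mf mg f0 g0.
have mind (D : set T) : measurable D ->
    measurable_fun setT (fun x => (\1_D x)%:E : \bar R).
  by move=> mD; apply/measurable_EFinP; exact: measurable_indic.
have mdf := measurable_distrib P mf; have mdg := measurable_distrib P mg.
under eq_integral do rewrite muleC.
rewrite layer_cake// .
(* [rearr] is itself a measure of level sets, those of [distrib]; exchanging integrals twice leaves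
   the length of an interval whose right end is the minimum. *)
have -> : \int[leb]_s (rearr f s * rearr g s) =
    \int[leb]_s \int[leb]_t mine (distrib P f s) (distrib P g t).
  transitivity (\int[leb]_s (rearr g s *
      \int[leb]_(x in level (distrib P f : RB -> _) s) cst 1 x)).
    apply: eq_integral => s _; rewrite integral_cst ?mul1e//; last first.
      exact: measurable_level.
    by rewrite muleC.
  rewrite -(@layer_cake_weighted _ _ RB leb _ (cst 1) (rearr g))//; last first.
    exact: measurable_rearr.
  apply: eq_integral => s _; rewrite mul1e.
  pose c := distrib P f s; rewrite -/c.
  pose I := [set s0 : R | (0 < s0)%R /\ s0%:E <= c].
  have mI : measurable (I : set RB).
    rewrite (_ : I = `]0%R, +oo[ `&` [set t : RB | t%:E <= c]).
      apply: measurableI => //; rewrite -[X in measurable X]setTI.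
      apply: measurable_lee => //; apply/measurable_EFinP; exact: measurable_id.
    by apply/seteqP; split => t; rewrite /I/= in_itv/= andbT.
  have mI1 : measurable_fun (setT : set RB) (fun x => (\1_I x)%:E : \bar R).
    by apply/measurable_EFinP; exact: measurable_indic.
  transitivity (\int[leb]_t ((\1_I t)%:E *
     \int[leb]_(x in level (distrib P g : RB -> _) t) cst 1 x)).
    rewrite [LHS]integral_mkcond; apply: eq_integral => t _.
    rewrite patchE indicE integral_cst ?mul1e; last exact: measurable_level.
    by case: ifPn; rewrite ?mul1e ?mul0e.
  rewrite -(@layer_cake_weighted _ _ RB leb _ (cst 1))//.
  apply: eq_integral => t _; rewrite mul1e.
  rewrite integral_indic//; last first.
    by rewrite -xsection_level; apply: measurable_xsection; exact: measurable_hypograph.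
  rewrite -[RHS]lebesgue_Ioc0; last by rewrite le_min !measure_ge0.
  congr (leb _); apply/seteqP; split => r /=.
    by move=> [[r0 rc] [_ rg]]; rewrite le_min rc rg.
  by rewrite le_min => -[r0 /andP[rc rg]].
have mmin : measurable_fun setT
    (fun p : RB * RB => mine (distrib P f p.1) (distrib P g p.2)).
  apply: measurable_mine.
    by apply: (measurableT_comp mdf); exact: measurable_fst.
  by apply: (measurableT_comp mdg); exact: measurable_snd.
have min0 (p : RB * RB) : 0 <= mine (distrib P f p.1) (distrib P g p.2).
  by rewrite le_min !measure_ge0.
have -> : \int[leb]_s \int[P]_(x in level f s) g x =
    \int[leb]_s \int[leb]_t P (level g t `&` level f s).
  apply: eq_integral => s _; rewrite integral_mkcond.
  have mfs := measurable_level s mf.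
  transitivity (\int[P]_x ((\1_(level f s) x)%:E * g x)).
    apply: eq_integral => x _; rewrite patchE indicE.
    by case: ifPn; rewrite ?mul1e ?mul0e.
  rewrite layer_cake//; last exact: mind.
  apply: eq_integral => t _; rewrite integral_indic//; last exact: measurable_level.
  by rewrite setIC.
have mE : measurable [set p : T * (RB * RB) |
    level g p.2.2 p.1 /\ level f p.2.1 p.1].
  apply: measurableI; rewrite -[X in measurable X]setTI.
    have m1 : measurable_fun setT (fun p : T * (RB * RB) => (p.1, p.2.2)).
      apply: measurable_fun_pair => //.
      by apply: (measurableT_comp measurable_snd); exact: measurable_snd.
    exact: (m1 measurableT _ (measurable_hypograph mg)).
  have m1 : measurable_fun setT (fun p : T * (RB * RB) => (p.1, p.2.1)).
    apply: measurable_fun_pair => //.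
    by apply: (measurableT_comp measurable_fst); exact: measurable_snd.
  exact: (m1 measurableT _ (measurable_hypograph mf)).
have mPE : measurable_fun setT
    (fun p : RB * RB => P (level g p.2 `&` level f p.1)).
  have := measurable_fun_ysection P mE.
  rewrite (_ : _ \o _ = fun p : RB * RB => P (level g p.2 `&` level f p.1))//.
  apply/funext => p /=; congr (P _).
  by apply/seteqP; split => x; rewrite /ysection/= inE.
apply: ge0_le_integral => //.
- by move=> s _; exact: integral_ge0.
- exact: (@measurable_fun_fubini_tonelli_F _ _ _ _ _ leb _ mPE).
- exact: (@measurable_fun_fubini_tonelli_F _ _ _ _ _ leb _ mmin).
- move=> s _; apply: ge0_le_integral => //.
  + exact: (measurableT_comp mPE (measurable_pair1 s)).
  + exact: (measurableT_comp mmin (measurable_pair1 s)).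
  + move=> t _; have [mfs mgt] := (measurable_level s mf, measurable_level t mg).
    by rewrite le_min !le_measure ?inE//; apply: measurableI.
Qed.

End Rearrangement.

Section Chebyshev.
Context {R : realType} {d} {T : measurableType d}.
Variable P : {sigma_finite_measure set T -> \bar R}.
Local Open Scope ereal_scope.

Lemma integral_mul_separated (F G : T -> \bar R) :
  measurable_fun setT F -> measurable_fun setT G ->
  (forall x, 0 <= F x) -> (forall x, 0 <= G x) ->
  \int[P]_x \int[P]_y (F x * G y) = \int[P]_x F x * \int[P]_y G y.
Proof.
move=> mF mG F0 G0; rewrite -ge0_integralZr//; last exact: integral_ge0.
by apply: eq_integral => x _; rewrite ge0_integralZl.
Qed.

(** The last hypothesis says that a / w and b are oppositely ordered, multiplied out so that [w] may
    vanish. Integrated over all pairs of points it is twice the conclusion. *)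
Lemma chebyshev_integral (a b w : T -> R) :
  measurable_fun setT a -> measurable_fun setT b -> measurable_fun setT w ->
  (forall x, 0 <= a x)%R -> (forall x, 0 <= b x)%R -> (forall x, 0 <= w x)%R ->
  (forall x y, a x * b x * w y + a y * b y * w x <=
               a x * (w y * b y) + a y * (w x * b x))%R ->
  \int[P]_x (a x * b x)%:E * \int[P]_x (w x)%:E <=
  \int[P]_x (a x)%:E * \int[P]_x (w x * b x)%:E.
Proof.
move=> ma mb mw a0 b0 w0 H.
have mab : measurable_fun setT (fun x => (a x * b x)%:E).
  by apply/measurable_EFinP; exact: measurable_funM.
have mwb : measurable_fun setT (fun x => (w x * b x)%:E).
  by apply/measurable_EFinP; exact: measurable_funM.
have ma' : measurable_fun setT (EFin \o a) by exact/measurable_EFinP.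
have mw' : measurable_fun setT (EFin \o w) by exact/measurable_EFinP.
have ab0 x : 0 <= (a x * b x)%:E by rewrite lee_fin mulr_ge0.
have wb0 x : 0 <= (w x * b x)%:E by rewrite lee_fin mulr_ge0.
have a0' x : 0 <= (a x)%:E by rewrite lee_fin.
have w0' x : 0 <= (w x)%:E by rewrite lee_fin.
have dbl (F G : T -> R) : measurable_fun setT F -> measurable_fun setT G ->
    (forall x, 0 <= F x)%R -> (forall x, 0 <= G x)%R ->
    \int[P]_x \int[P]_y (F x * G y + F y * G x)%:E =
    2%:E * (\int[P]_x (F x)%:E * \int[P]_x (G x)%:E).
  move=> mF mG F0 G0.
  have mF' : measurable_fun setT (EFin \o F) by exact/measurable_EFinP.
  have mG' : measurable_fun setT (EFin \o G) by exact/measurable_EFinP.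
  have F0' x : 0 <= (F x)%:E by rewrite lee_fin.
  have G0' x : 0 <= (G x)%:E by rewrite lee_fin.
  transitivity (\int[P]_x (\int[P]_y ((F x)%:E * (G y)%:E) +
                           \int[P]_y ((G x)%:E * (F y)%:E))).
    apply: eq_integral => x _; rewrite -ge0_integralD//.
    - by apply: eq_integral => y _; rewrite -!EFinM -EFinD (mulrC (G x)).
    - by move=> y _; rewrite mule_ge0.
    - exact: measurable_funeM.
    - by move=> y _; rewrite mule_ge0.
    - exact: measurable_funeM.
  have mD (F1 G1 : T -> \bar R) : measurable_fun setT F1 ->
      measurable_fun setT G1 -> (forall x, 0 <= F1 x) -> (forall x, 0 <= G1 x) ->
      measurable_fun setT (fun x => \int[P]_y (F1 x * G1 y)).
    move=> mF1 mG1 F10 G10.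
    rewrite (_ : (fun x => _) = (fun x => F1 x * \int[P]_y G1 y)).
      exact: emeasurable_funM.
    by apply/funext => x; rewrite ge0_integralZl.
  rewrite ge0_integralD//; last 4 first.
  - by move=> x _; apply: integral_ge0 => y _; rewrite mule_ge0.
  - exact: (mD _ _ mF' mG').
  - by move=> x _; apply: integral_ge0 => y _; rewrite mule_ge0.
  - exact: (mD _ _ mG' mF').
  rewrite !(@integral_mul_separated (EFin \o _) (EFin \o _))//.
  by rewrite muleC -mule2n muleC mule_natl.
rewrite -(@lee_pmul2l _ 2%:E)// -!dbl//; last 2 first.
- exact: measurable_funM.
- exact: measurable_funM.
have mint (F G : T -> R) : measurable_fun setT F -> measurable_fun setT G ->
    measurable_fun setT (fun p : T * T => (F p.1 * G p.2 + F p.2 * G p.1)%:E).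
  move=> mF mG; apply/measurable_EFinP.
  have m1 (H1 : T -> R) : measurable_fun setT H1 ->
      measurable_fun setT (fun p : T * T => H1 p.1).
    by move=> mH1; apply: (measurableT_comp mH1); exact: measurable_fst.
  have m2 (H1 : T -> R) : measurable_fun setT H1 ->
      measurable_fun setT (fun p : T * T => H1 p.2).
    by move=> mH1; apply: (measurableT_comp mH1); exact: measurable_snd.
  by apply: measurable_funD; apply: measurable_funM; auto.
have mwb' : measurable_fun setT (fun x => w x * b x)%R by exact: measurable_funM.
have mab' : measurable_fun setT (fun x => a x * b x)%R by exact: measurable_funM.
have nn1 x y : 0 <= (a x * b x * w y + a y * b y * w x)%:E.
  by rewrite lee_fin; apply: addr_ge0; do 2! [apply: mulr_ge0 => //].
have nn2 x y : 0 <= (a x * (w y * b y) + a y * (w x * b x))%:E.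
  by rewrite lee_fin; apply: addr_ge0; do 2! [apply: mulr_ge0 => //].
apply: ge0_le_integral => //.
- by move=> x _; exact: integral_ge0.
- exact: (@measurable_fun_fubini_tonelli_F _ _ _ _ _ P _ (mint _ _ mab' mw)).
- exact: (@measurable_fun_fubini_tonelli_F _ _ _ _ _ P _ (mint _ _ ma mwb')).
- move=> x _; apply: ge0_le_integral => //.
  + exact: (measurableT_comp (mint _ _ mab' mw) (measurable_pair1 x)).
  + exact: (measurableT_comp (mint _ _ ma mwb') (measurable_pair1 x)).
  + by move=> y _; rewrite lee_fin H.
Qed.

End Chebyshev.

Section DistributionBounds.
Context {R : realType} {d} {T : measurableType d}.
Local Notation RB := (measurableTypeR R).
Local Notation leb := (@lebesgue_measure R).
Variable P : {sigma_finite_measure set T -> \bar R}.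
Local Open Scope ereal_scope.

Lemma level_le f (s t : R) : (0 < s <= t)%R -> level f t `<=` @level R d T f s.
Proof.
move=> /andP[s0 st] x [t0 tf]; split => //; apply: le_trans tf.
by rewrite lee_fin.
Qed.

Lemma distrib_le f (s t : R) : measurable_fun setT f ->
  (0 < s <= t)%R -> distrib P f t <= distrib P f s.
Proof.
by move=> mf st; rewrite le_measure ?inE//;
  [exact: measurable_level|exact: measurable_level|exact: level_le].
Qed.

Lemma distrib_npos f (s : R) : (s <= 0)%R -> distrib P f s = 0.
Proof.
move=> s0; rewrite /distrib (_ : level _ _ = set0) ?measure0//.
by apply/seteqP; split => x // -[]; rewrite ltNge s0.
Qed.

End DistributionBounds.

Section InverseBounds.
Context {R : realType} {d} {T : measurableType d}.
Local Notation RB := (measurableTypeR R).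
Local Notation leb := (@lebesgue_measure R).
Variable P : {sigma_finite_measure set T -> \bar R}.
Local Open Scope ereal_scope.

(** Since [distrib] decreases on positive heights, the heights at which it is at least [t] fill an
    interval starting at 0, of length [rearr P f t]. This lemma and [rearr_le] bound that length
    from below and from above. *)
Lemma le_rearr f (s t : R) : measurable_fun setT f -> (0 < t)%R ->
  t%:E <= distrib P f s -> s%:E <= rearr P f t.
Proof.
move=> mf t0 ts.
have [s0|s0] := leP s 0%R; first exact: (le_trans _ (distrib_ge0 _ _ _)).
have : leb `]0%R, s]%classic <= rearr P f t.
  rewrite le_measure ?inE//; first by apply: measurable_level; exact: measurable_distrib.
  move=> r /=; rewrite in_itv/= => r0s; split => //; apply: le_trans ts _.
  exact: distrib_le.
by rewrite lebesgue_measure_itv/= lte_fin s0 oppr0 adde0.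
Qed.

Lemma rearr_le f (c t : R) : measurable_fun setT f -> (0 <= c)%R ->
  (forall s, (0 < s)%R -> t%:E <= distrib P f s -> (s <= c)%R) ->
  rearr P f t <= c%:E.
Proof.
move=> mf c0 H.
have [t0|t0] := leP t 0%R; first by rewrite /rearr distrib_npos.
have : rearr P f t <= leb `]0%R, c]%classic.
  rewrite le_measure ?inE//; first by apply: measurable_level; exact: measurable_distrib.
  move=> r [_ rt] /=; rewrite in_itv/=.
  have [r0|r0] := leP r 0%R; last exact: H.
  by move: rt; rewrite distrib_npos// leNgt lte_fin t0.
move=> /le_trans; apply; rewrite lebesgue_measure_itv/= lte_fin.
by case: ltP => // _; rewrite oppr0 adde0.
Qed.

End InverseBounds.

(** * Tent functions and beta integrals *)

Section Profile.
Context {R : realType}.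
Local Notation RB := (measurableTypeR R).
Local Notation leb := (@lebesgue_measure R).

Lemma integral_exprn (n : nat) (c : R) : 0 <= c ->
  (\int[leb]_(s in [set s : R | (0 < s)%R /\ s%:E <= c%:E])
    (n.+1%:R * s ^+ n)%:E = (c ^+ n.+1)%:E)%E.
Proof.
move=> c0; rewrite (_ : [set _ | _] = `]0, c]%classic); last first.
  by apply/seteqP; split => s /=; rewrite in_itv/= lee_fin => /andP.
have cn : continuous (fun s : R => n.+1%:R * s ^+ n).
  by move=> x; apply: cvgM; [exact: cvg_cst|exact: exprn_continuous].
rewrite integral_itv_obnd_cbnd; last first.
  apply/measurable_EFinP; apply: measurable_funTS.
  exact: continuous_measurable_fun.
move: c0; rewrite le_eqVlt => /predU1P[<-|c0].
  by rewrite set_itv1 integral_set1 expr0n.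
rewrite (@continuous_FTC2 _ _ (fun x : R => x ^+ n.+1))//.
- by rewrite expr0n/= oppr0 adde0.
- exact: continuous_subspaceT.
- split.
  + by move=> x _; exact: exprn_derivable.
  + by apply: cvg_at_right_filter; exact: exprn_continuous.
  + by apply: cvg_at_left_filter; exact: exprn_continuous.
- by move=> x _; rewrite exp_derive1.
Qed.

(** The decreasing rearrangement of one minus the gauge on a convex body of dimension [k] and volume
    [V], the extremal case in Berwald's inequality: the level at height s has measure V (1 -
    s)^k. *)
Definition tent (V : R) (k : nat) (t : R) : R :=
  if (0 < t <= V) then 1 - (t / V) `^ (k%:R^-1) else 0.

Variables (V : R) (k : nat).
Hypotheses (V0 : 0 < V) (k0 : (0 < k)%N).

Lemma powRinvK (x : R) : 0 <= x -> (x `^ (k%:R^-1)) ^+ k = x.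
Proof.
move=> x0; rewrite -powR_mulrn ?powR_ge0// -powRrM mulVf ?powRr1//.
by rewrite pnatr_eq0 -lt0n.
Qed.

Lemma le_powRinv (x y : R) : 0 <= x -> 0 <= y ->
  (x `^ (k%:R^-1) <= y) = (x <= y ^+ k).
Proof.
move=> x0 y0; rewrite -[in RHS](powRinvK x0) ler_pXn2r// ?nnegrE ?powR_ge0//.
Qed.

Lemma powRinv_le1 t : 0 < t <= V -> (t / V) `^ (k%:R^-1) <= 1.
Proof.
move=> /andP[t0 tV]; rewrite le_powRinv//; last by rewrite divr_ge0// ltW.
by rewrite expr1n ler_pdivrMr// mul1r.
Qed.

Lemma tent_ge0 t : 0 <= tent V k t.
Proof. by rewrite /tent; case: ifP => // tV; rewrite subr_ge0 powRinv_le1. Qed.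

Lemma tent_le1 t : tent V k t <= 1.
Proof.
by rewrite /tent; case: ifP => // tV; rewrite lerBlDl lerDr powR_ge0.
Qed.

Lemma measurable_tent : measurable_fun (setT : set RB) (tent V k : RB -> R).
Proof.
rewrite (_ : tent V k = (fun t => \1_(`]0, V]%classic) t * (1 - (t / V) `^ (k%:R^-1)))).
  apply: measurable_funM; first exact: measurable_indic.
  apply: measurable_funB => //; apply: (measurableT_comp (measurable_powR _)).
  by apply: measurable_funM => //; exact: measurable_id.
apply/funext => t; rewrite /tent indicE mem_setE in_itv/=.
by case: ifP; rewrite ?mul1r ?mul0r.
Qed.

Lemma level_tent s : 0 < s <= 1 ->
  level (EFin \o (tent V k : RB -> R)) s = `]0, V * (1 - s) ^+ k]%classic.
Proof.
move=> /andP[s0 s1]; apply/seteqP; split => t /=.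
  move=> [_]; rewrite lee_fin /tent; case: ifPn => [|_]; last first.
    by rewrite leNgt s0.
  move=> /andP[t0 tV]; rewrite lerBrDl -lerBrDr.
  rewrite le_powRinv ?subr_ge0//; last by rewrite divr_ge0// ltW.
  rewrite in_itv/= t0/=.
  by rewrite ler_pdivrMr// mulrC.
rewrite in_itv/= => /andP[t0 tV]; split => //; rewrite lee_fin /tent t0/=.
have -> : t <= V.
  apply: (le_trans tV); rewrite -[leRHS]mulr1 ler_pM2l//.
  by rewrite exprn_ile1// ?subr_ge0// gerBl ltW.
rewrite lerBrDl -lerBrDr le_powRinv ?subr_ge0//; last by rewrite divr_ge0// ltW.
by rewrite ler_pdivrMr// mulrC.
Qed.

(** By layer cake the integral is V p times the integral of s^(p-1) (1 - s)^k over the unit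
    interval, a beta integral. *)
Lemma integral_tent (p : nat) : (0 < p)%N ->
  (\int[leb]_t ((tent V k t) ^+ p)%:E =
   (V * (k`!%:R * p`!%:R / (k + p)`!%:R))%:E)%E.
Proof.
case: p => // p _.
(* The layer cake formula asks for a weight that is nonnegative on the whole line, hence the
   truncation at 0. *)
pose b : RB -> \bar R := fun s => (p.+1%:R * (Num.max s 0) ^+ p)%:E.
have mb : measurable_fun setT b.
  apply/measurable_EFinP; apply: measurable_funM => //.
  by apply: measurable_funX; apply: measurable_maxr => //; exact: measurable_id.
transitivity (\int[leb]_x (cst 1 x * \int[leb]_(s in
   [set s : R | (0 < s)%R /\ s%:E <= (EFin \o (tent V k : RB -> R)) x]) b s))%E.
  apply: eq_integral => t _; rewrite mul1e/= -(integral_exprn p (tent_ge0 t)).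
  by apply: eq_integral => s /set_mem[s0 _]; rewrite /b max_l// ltW.
rewrite layer_cake_weighted//; last 3 first.
- by apply/measurable_EFinP; exact: measurable_tent.
- by move=> x; rewrite lee_fin tent_ge0.
- by move=> s; rewrite lee_fin mulr_ge0// exprn_ge0// le_max lexx orbT.
transitivity (\int[leb]_(s in `]0%R, 1%R]) ((V * p.+1%:R)%:E * (XMonemX p k s)%:E))%E.
  rewrite [RHS]integral_mkcond; apply: eq_integral => s _.
  rewrite patchE mem_setE in_itv/= integral_cst; last first.
    apply: measurable_level; apply/measurable_EFinP; exact: measurable_tent.
  rewrite mul1e; case: ifPn => [/andP[s0 s1]|].
    rewrite level_tent ?s0//. rewrite [X in (_ * X)%E]lebesgue_measure_itv/= lte_fin.
    rewrite /b max_l ?ltW// (_ : XMonemX p k s = s ^+ p * (1 - s) ^+ k)//; case: ifPn => [_|].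
      by rewrite oppr0 adde0 -!EFinM; congr EFin; ring.
    rewrite pmulr_rgt0// -leNgt => h.
    have -> : (1 - s) ^+ k = 0.
      by apply/le_anti; rewrite h exprn_ge0// subr_ge0.
    by rewrite mulr0 !mule0.
  rewrite negb_and -leNgt -ltNge => /orP[s0|s1].
    rewrite [X in (_ * X)%E](_ : _ = 0%E) ?mule0//.
    exact: (distrib_npos leb (EFin \o (tent V k : RB -> R)) s0).
  rewrite (_ : level _ _ = set0) ?measure0 ?mule0//.
  apply/seteqP; split => t //= -[_]; rewrite lee_fin leNgt.
  by rewrite (le_lt_trans (tent_le1 t)).
rewrite integral_itv_obnd_cbnd; last first.
  apply: measurable_funTS; apply: measurable_funeM; apply/measurable_EFinP.
  exact: measurable_XMonemX.
rewrite ge0_integralZl//; last 3 first.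
- apply/measurable_EFinP/measurable_funTS.
  exact: measurable_XMonemX.
- by move=> s s01; rewrite lee_fin XMonemX_ge0.
- by rewrite lee_fin mulr_ge0// ltW.
transitivity ((V * p.+1%:R)%:E * (beta_fun p.+1 k.+1)%:E)%E.
  rewrite EFin_beta_fun integral_mkcond; congr (_ * _)%E.
  by apply: eq_integral => s _; rewrite !patchE; case: ifP.
rewrite beta_fun_fact -EFinM; congr EFin.
by rewrite (factS p) (natrM _ p.+1) (natrM _ p`!) (addnC k) addSn; ring.
Qed.

End Profile.

Section Berwald.
Context {R : realType} {d} {T : measurableType d}.
Local Notation RB := (measurableTypeR R).
Local Notation leb := (@lebesgue_measure R).
Variable P : {sigma_finite_measure set T -> \bar R}.
Variables (V : R) (k : nat).
Hypotheses (V0 : 0 < V) (k0 : (0 < k)%N).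

(* By Brunn--Minkowski, this holds for the y-th power of a concave function on a
   convex set of dimension k and measure V, whose superlevel sets at heights
   between 0 and s interpolate between that set and the level set at s. *)
Definition concave_levels (y : nat) (f : T -> \bar R) : Prop :=
  [/\ forall s, 0 < s -> (distrib P f s <= V%:E)%E,
      exists M, forall x, (f x <= M%:E)%E
    & forall r l s, 0 < r -> 0 < l < 1 -> 0 < s ->
        ((V * r ^+ k)%:E <= distrib P f s)%E ->
        ((V * ((1 - l) * r + l) ^+ k)%:E <=
         distrib P f ((1 - l) ^+ y * s)%R)%E].

Section OneFunction.
Variables (y : nat) (f : T -> \bar R).
Hypotheses (mf : measurable_fun setT f) (f0 : forall x, (0 <= f x)%E).
Hypotheses (y0 : (0 < y)%N) (cf : concave_levels y f).

Let a (t : RB) : R := fine (rearr P f t).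

Lemma rearr_fin t : rearr P f t = (a t)%:E.
Proof.
have [uV [M fM] _] := cf.
rewrite /a fineK// ge0_fin_numE; last exact: distrib_ge0.
have [t0|t0] := leP t 0; first by rewrite /rearr distrib_npos// ltry.
apply: (@le_lt_trans _ _ (Num.max M 0)%:E); last exact: ltry.
apply: rearr_le => //; first by rewrite le_max lexx orbT.
move=> s s0 ts; rewrite leNgt; apply/negP; rewrite gt_max => /andP[Ms _].
move: ts; rewrite /distrib (_ : level f s = set0).
  by rewrite measure0 lee_fin leNgt t0.
apply/seteqP; split => x // -[_ /le_trans/(_ (fM x))].
by rewrite lee_fin leNgt Ms.
Qed.

Lemma rearr_ge0 t : 0 <= a t.
Proof. by rewrite fine_ge0// distrib_ge0. Qed.

Lemma measurable_fine_rearr : measurable_fun setT a.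
Proof.
by apply: measurableT_comp => //; exact: measurable_rearr.
Qed.

Lemma rearr_out t : ~~ (0 < t <= V) -> a t = 0.
Proof.
have [uV _ _] := cf.
rewrite negb_and -leNgt -ltNge => /orP[t0|tV].
  by rewrite /a /rearr distrib_npos.
apply/le_anti; rewrite rearr_ge0 andbT -lee_fin -rearr_fin.
apply: rearr_le => // s s0 /le_trans/(_ (uV s s0)).
by rewrite lee_fin leNgt tV.
Qed.

Lemma rearr_nincr t1 t2 : 0 < t1 -> t1 <= t2 -> a t2 <= a t1.
Proof.
move=> t10 t12; rewrite -lee_fin -!rearr_fin.
by apply: distrib_le; rewrite ?t10//; exact: measurable_distrib.
Qed.

(** A level set of measure at least [t1] at height s forces, by [concave_levels], one of measure at
    least [t2] at height q^y s, where q is the quotient of the tents at [t2] and [t1]. The bound is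
    multiplied out because [tent] vanishes at [V]. *)
Lemma rearr_tent t1 t2 : 0 < t1 -> t1 <= t2 -> t2 <= V ->
  a t1 * tent V k t2 ^+ y <= a t2 * tent V k t1 ^+ y.
Proof.
have [uV _ cvx] := cf.
move=> t10 t12 t2V; have t20 : 0 < t2 by exact: lt_le_trans t12.
have t1V : t1 <= V by exact: le_trans t2V.
pose r t := (t / V) `^ (k%:R^-1).
have rE t : 0 < t -> V * r t ^+ k = t.
  move=> t0; rewrite powRinvK ?divr_ge0 ?(ltW t0) ?(ltW V0)//.
  by rewrite mulrC divfK// gt_eqF.
have tentE t : 0 < t -> t <= V -> tent V k t = 1 - r t.
  by move=> t0 tV; rewrite /tent t0 tV.
have [->|t1t2] := eqVneq t1 t2; first by [].
have r12 : r t1 < r t2.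
  apply: gt0_ltr_powR; rewrite ?invr_gt0 ?ltr0n ?nnegrE ?divr_ge0 ?ltW//.
  by rewrite ltr_pM2r ?invr_gt0// lt_neqAle t1t2.
have r2 : r t2 <= 1 by apply: powRinv_le1 => //; rewrite t20.
have r1 : r t1 < 1 by exact: lt_le_trans r2.
move: r2; rewrite le_eqVlt => /predU1P[r21|r2].
  rewrite [X in _ * X ^+ _ <= _]tentE// r21 subrr expr0n.
  by rewrite gtn_eqF//= mulr0 mulr_ge0 ?rearr_ge0 ?exprn_ge0 ?tent_ge0.
(* For l = 1 - q the interpolated radius (1 - l) r(t1) + l equals r(t2). *)
pose q := (1 - r t2) / (1 - r t1).
have q0 : 0 < q by rewrite divr_gt0 ?subr_gt0.
have q1 : q < 1 by rewrite ltr_pdivrMr ?subr_gt0// mul1r ltrD2l ltrN2.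
rewrite !tentE//.
have -> : 1 - r t2 = q * (1 - r t1) by rewrite divfK// gt_eqF// subr_gt0.
rewrite exprMn mulrA ler_wpM2r ?exprn_ge0 ?subr_ge0 ?(ltW r1)//.
rewrite -ler_pdivlMr ?exprn_gt0// -lee_fin -rearr_fin.
apply: rearr_le => //; first by rewrite divr_ge0 ?rearr_ge0 ?exprn_ge0 ?ltW.
move=> s s0 ts; rewrite ler_pdivlMr ?exprn_gt0// -lee_fin -rearr_fin.
apply: le_rearr => //; rewrite mulrC.
have := cvx (r t1) (1 - q) s (powR_gt0 _ (divr_gt0 t10 V0)).
rewrite rE// subKr => /(_ _ s0 ts).
have -> : q * r t1 + (1 - q) = r t2.
  rewrite (_ : _ + _ = 1 - q * (1 - r t1)); last by ring.
  by rewrite divfK ?subKr// gt_eqF// subr_gt0.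
by rewrite rE//; apply; rewrite subr_gt0 q1 gtrBl.
Qed.

End OneFunction.

Lemma concave_levels_cheb y f (b : RB -> R) : (0 < y)%N ->
  measurable_fun setT f -> (forall x, 0 <= f x)%E -> concave_levels y f ->
  measurable_fun setT b -> (forall t, 0 <= b t) ->
  (forall t1 t2, 0 < t1 -> t1 <= t2 -> t2 <= V -> b t2 <= b t1) ->
  (\int[leb]_t (fine (rearr P f t) * b t)%:E *
   \int[leb]_t (tent V k t ^+ y)%:E <=
   \int[leb]_t (rearr P f t) * \int[leb]_t (tent V k t ^+ y * b t)%:E)%E.
Proof.
move=> y0 mf f0 cf mb b0 nb; pose a t := fine (rearr P f t).
have a0 t : 0 <= a t by exact: rearr_ge0.
have w0 t : 0 <= tent V k t ^+ y by rewrite exprn_ge0// tent_ge0.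
have -> : (\int[leb]_t (rearr P f t) = \int[leb]_t (a t)%:E)%E.
  by apply: eq_integral => t _; rewrite -(rearr_fin mf cf).
apply: (@chebyshev_integral _ _ RB leb a b (fun t => tent V k t ^+ y)) => //.
- exact: measurable_fine_rearr.
- apply: measurable_funX; exact: measurable_tent.
move=> t1 t2.
wlog t12 : t1 t2 / t1 <= t2.
  move=> H; have [/H//|/ltW/H] := leP t1 t2.
  by rewrite [X in X <= _ -> _]addrC [X in _ <= X -> _]addrC.
have out t : ~~ (0 < t <= V) -> a t = 0 /\ tent V k t ^+ y = 0.
  move=> tV; split; first exact: (rearr_out mf cf tV).
  by rewrite /tent (negbTE tV) expr0n gtn_eqF.
have [/andP[t10 t1V]|/out[-> ->]] := boolP (0 < t1 <= V); last first.
  by rewrite !(mul0r, mulr0, addr0).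
have [/andP[t20 t2V]|/out[-> ->]] := boolP (0 < t2 <= V); last first.
  by rewrite !(mul0r, mulr0, addr0, add0r).
have ra := rearr_tent mf y0 cf t10 t12 t2V.
have bb := nb _ _ t10 t12 t2V.
rewrite -subr_ge0.
rewrite (_ : _ - _ = (a t2 * tent V k t1 ^+ y - a t1 * tent V k t2 ^+ y) *
  (b t1 - b t2)); last by ring.
by rewrite mulr_ge0// subr_ge0.
Qed.

Lemma tent_nincr t1 t2 : 0 < t1 -> t1 <= t2 -> t2 <= V ->
  tent V k t2 <= tent V k t1.
Proof.
move=> t10 t12 t2V; rewrite /tent t10 (lt_le_trans t10 t12) t2V (le_trans t12 t2V)/=.
rewrite lerD2l lerN2; apply: ge0_ler_powR; rewrite ?invr_ge0 ?nnegrE//.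
- by rewrite divr_ge0// ltW.
- by rewrite divr_ge0 ?(ltW V0)// (le_trans (ltW t10)).
- by rewrite ler_pM2r ?invr_gt0.
Qed.

(** With J(p) = k! p! / (k + p)!, the integral of the p-th power of a tent of volume 1, this is J(y
    + z) / (J(y) J(z)). *)
Definition berwald_const (k y z : nat) : R :=
  ((k + y)`! * (k + z)`! * (y + z)`!)%N%:R /
  (k`! * y`! * z`! * (k + y + z)`!)%N%:R.

(* Each rearrangement divided by the corresponding power of the tent function
   is nondecreasing, so that Chebyshev's inequality, applied once per function,
   compares the product with the product of the two tent powers. *)
Lemma berwald y z f g : (0 < y)%N -> (0 < z)%N ->
  measurable_fun setT f -> (forall x, 0 <= f x)%E -> concave_levels y f ->
  measurable_fun setT g -> (forall x, 0 <= g x)%E -> concave_levels z g ->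
  (\int[P]_x (f x * g x) * V%:E <=
   (berwald_const k y z)%:E * (\int[P]_x f x * \int[P]_x g x))%E.
Proof.
move=> y0 z0 mf f0 cf mg g0 cg.
pose a t := fine (rearr P f t); pose b t := fine (rearr P g t).
have b0 t : 0 <= b t by exact: rearr_ge0.
have mb : measurable_fun setT (b : RB -> R) by exact: measurable_fine_rearr.
have mT p : measurable_fun setT (fun t : RB => tent V k t ^+ p).
  by apply: measurable_funX; exact: measurable_tent.
have T0 p t : 0 <= tent V k t ^+ p by rewrite exprn_ge0// tent_ge0.
have := integral_mul_le_rearr P mf mg f0 g0.
rewrite -(integral_rearr P mf f0) -(integral_rearr P mg g0).
have -> : (\int[leb]_t (rearr P f t * rearr P g t) =
           \int[leb]_t (a t * b t)%:E)%E.
  by apply: eq_integral => t _; rewrite EFinM -(rearr_fin mf cf) -(rearr_fin mg cg).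
have c1 := concave_levels_cheb y0 mf f0 cf mb b0
  (fun t1 t2 t10 t12 _ => rearr_nincr mg cg t10 t12).
have tn t1 t2 : 0 < t1 -> t1 <= t2 -> t2 <= V ->
    tent V k t2 ^+ y <= tent V k t1 ^+ y.
  by move=> t10 t12 t2V; rewrite lerXn2r ?nnegrE ?tent_ge0// tent_nincr.
have c2 := concave_levels_cheb z0 mg g0 cg (mT y) (T0 y) tn.
set N := (\int[P]_x _)%E.
set A := (\int[leb]_t rearr P f t)%E in c1 *.
set B := (\int[leb]_t rearr P g t)%E in c2 *.
have A0 : (0 <= A)%E by apply: integral_ge0 => t _; exact: distrib_ge0.
have B0 : (0 <= B)%E by apply: integral_ge0 => t _; exact: distrib_ge0.
have N0 : (0 <= N)%E by apply: integral_ge0 => t _; rewrite mule_ge0.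
move=> NAB.
rewrite integral_tent// in c1; rewrite integral_tent// in c2.
pose J p : R := k`!%:R * p`!%:R / (k + p)`!%:R.
have f00 p : 0 < p`!%:R :> R by rewrite ltr0n fact_gt0.
have J0 p : 0 < J p by rewrite divr_gt0// mulr_gt0.
rewrite -/(J y) in c1; rewrite -/(J z) in c2.
have e2 : (\int[leb]_t (tent V k t ^+ z * tent V k t ^+ y)%:E = (V * J (y + z)%N)%:E)%E.
  rewrite /J -integral_tent// ?addn_gt0 ?y0//.
  by apply: eq_integral => t _; rewrite -exprD addnC.
rewrite e2 in c2.
have e1 : (\int[leb]_t (tent V k t ^+ y * b t)%:E =
           \int[leb]_t (b t * tent V k t ^+ y)%:E)%E.
  by apply: eq_integral => t _; rewrite mulrC.
rewrite e1 in c1.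
set X := (\int[leb]_t (b t * _)%:E)%E in c1 c2.
have X0 : (0 <= X)%E by apply: integral_ge0 => t _; rewrite lee_fin mulr_ge0.
have c0 : 0 < V * J y * J z by rewrite !mulr_gt0.
(* This factor lets [c1] and then [c2] apply, the mixed integral [X] serving as the intermediate
   term. *)
rewrite -(@lee_pmul2r _ (V * J y * J z)%:E)//.
apply: (@le_trans _ _ (A * X * (V * J z)%:E))%E.
  have -> : (N * V%:E * (V * J y * J z)%:E = N * (V * J y)%:E * (V * J z)%:E)%E.
    by rewrite -!muleA -!EFinM; congr (_ * _%:E)%E; ring.
  apply: lee_wpmul2r; first by rewrite lee_fin mulr_ge0// ltW.
  apply: le_trans c1; apply: lee_wpmul2r => //.
  by rewrite lee_fin mulr_ge0// ltW.
have -> : ((berwald_const k y z)%:E * (A * B) * (V * J y * J z)%:E =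
           A * (B * (V * J (y + z)%N)%:E))%E.
  rewrite muleC muleA -EFinM muleC -muleA; congr (_ * (_ * _%:E))%E.
  rewrite /berwald_const /J !natrM !addnA; field.
  by rewrite !gt_eqF.
by rewrite -muleA; apply: lee_wpmul2l.
Qed.

End Berwald.

(** * Brunn--Minkowski inequality for decreasing densities *)

Section OneDimensionalBM.
Context {R : realType}.
Local Notation RB := (measurableTypeR R).
Local Notation leb := (@lebesgue_measure R).

(** The last clause is the Brunn--Minkowski inequality for the intervals [0, c], in its linear form;
    the second makes open and closed ends indistinguishable. *)
Definition concave_distribution (m : set RB -> \bar R) : Prop :=
  [/\ forall c : R, (m `[0%R, c]%classic < +oo)%E,
      forall c : R, m [set c] = 0%E
    & forall a b l : R, 0 <= a -> 0 <= b -> 0 < l < 1 ->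
      ((1 - l)%R%:E * m `[0%R, a]%classic + l%:E * m `[0%R, b]%classic <=
       m `[0%R, ((1 - l) * a + l * b)%R]%classic)%E].

Lemma convex_exprn (n : nat) (u v x y : R) : 0 <= u -> 0 <= v -> u + v = 1 ->
  0 <= x -> 0 <= y -> (u * x + v * y) ^+ n <= u * x ^+ n + v * y ^+ n.
Proof.
move=> u0 v0 uv x0 y0; elim: n => [|n IH]; first by rewrite !expr0 !mulr1 uv.
rewrite exprS.
apply: (@le_trans _ _ ((u * x + v * y) * (u * x ^+ n + v * y ^+ n))).
  by rewrite ler_wpM2l// addr_ge0// mulr_ge0.
have H : 0 <= (x - y) * (x ^+ n - y ^+ n).
  have [xy|/ltW yx] := leP x y.
    by rewrite mulr_le0 ?subr_le0 ?lerXn2r ?nnegrE.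
  by rewrite mulr_ge0 ?subr_ge0 ?lerXn2r ?nnegrE.
have vE : v = 1 - u by rewrite -uv addrC addKr.
rewrite -subr_ge0 !exprS.
rewrite (_ : _ - _ = u * v * ((x - y) * (x ^+ n - y ^+ n))).
  by rewrite mulr_ge0// mulr_ge0.
by rewrite vE; ring.
Qed.

Variable m : {sigma_finite_measure set RB -> \bar R}.
Hypothesis cm : concave_distribution m.

(** Since [f] and [g] both have maximum 1 at 0, their level sets are nonempty at exactly the heights
    in (0, 1]. At such a height these sets lie in [0, a] and [0, b] with a, b their suprema, while
    the level set of the decreasing [h] contains every nonnegative point below (1 - l) a + l b.
    Concavity compares the measures, and layer cake integrates over the heights. *)
Lemma distrib_superadditive (f g h : RB -> \bar R) (l M : R) :
  0 < l < 1 ->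
  measurable_fun setT f -> measurable_fun setT g -> measurable_fun setT h ->
  (forall t, 0 <= f t <= 1)%E -> (forall t, 0 <= g t <= 1)%E ->
  (forall t, 0 <= h t)%E ->
  f 0 = 1%E -> g 0 = 1%E ->
  (forall t, ~~ (0 <= t <= M) -> f t = 0%E /\ g t = 0%E) ->
  (forall t t', 0 <= t -> t <= t' -> (h t' <= h t)%E) ->
  (forall r t t', 0 < r -> r <= 1 -> 0 <= t -> 0 <= t' ->
    (r%:E <= f t)%E -> (r%:E <= g t')%E ->
    (r%:E <= h ((1 - l) * t + l * t')%R)%E) ->
  ((1 - l)%R%:E * \int[m]_t f t + l%:E * \int[m]_t g t <= \int[m]_t h t)%E.
Proof.
move=> l01 mf mg mh f01 g01 h0 f1 g1 fgM nh H.
have /andP[l0 l1] := l01; have l'0 : 0 < 1 - l by rewrite subr_gt0.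
have [finm atom conc] := cm.
have f0 t : (0 <= f t)%E by case/andP: (f01 t).
have g0 t : (0 <= g t)%E by case/andP: (g01 t).
rewrite (integral_distrib m mf f0) (integral_distrib m mg g0) (integral_distrib m mh h0).
rewrite -!ge0_integralZl//; [|exact: measurable_distrib|by rewrite lee_fin ltW
  |exact: measurable_distrib|by rewrite lee_fin ltW].
have mdist (c : R) F : 0 < c -> measurable_fun (setT : set RB) F ->
    measurable_fun (setT : set RB) (fun s => c%:E * distrib m F s)%E.
  by move=> c0 mF; apply: measurable_funeM; exact: measurable_distrib.
have dist0 (c : R) F s : 0 < c -> (0 <= c%:E * distrib m F s)%E.
  by move=> c0; rewrite mule_ge0 ?distrib_ge0// lee_fin ltW.
rewrite -ge0_integralD//; [|by move=> s _; exact: dist0|exact: mdist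
  |by move=> s _; exact: dist0|exact: mdist].
apply: ge0_le_integral => //.
- by move=> s _; rewrite adde_ge0// dist0.
- by apply: emeasurable_funD; exact: mdist.
- exact: measurable_distrib.
move=> s _.
have [s0|s0] := leP s 0; first by rewrite !(distrib_npos m _ s0) !mule0 adde0.
have [s1|s1] := leP s 1; last first.
  have z (F : RB -> \bar R) : (forall t, 0 <= F t <= 1)%E -> distrib m F s = 0%E.
    move=> F1; rewrite /distrib (_ : level F s = set0) ?measure0//.
    apply/seteqP; split => t // -[_]; apply/negP; rewrite -ltNge.
    by case/andP: (F1 t) => _ /le_lt_trans; apply; rewrite lte_fin.
  by rewrite (z f)// (z g)// !mule0 adde0 distrib_ge0.
have key (F : RB -> \bar R) : (forall t, ~~ (0 <= t <= M) -> F t = 0%E) -> F 0 = 1%E ->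
    measurable_fun setT F ->
    exists a : R, [/\ 0 <= a, (distrib m F s <= m `[0%R, a]%classic)%E
      & forall e, 0 < e -> exists2 t, level F s t & 0 <= t /\ a - e < t].
  move=> FM F1 mF.
  have FsM : level F s `<=` `[0%R, M]%classic.
    move=> t [_ sF]; rewrite /= in_itv/=; apply/negPn/negP => tM.
    by move: sF; rewrite (FM _ tM) lee_fin leNgt s0.
  have F0s : level F s 0 by split => //; rewrite F1 lee_fin.
  have hs : has_sup (level F s).
    split; first by exists 0.
    by exists M => t /FsM; rewrite /= in_itv/= => /andP[].
  have ub : forall t, level F s t -> t <= sup (level F s).
    by move=> t; exact: (ub_le_sup hs.2).
  exists (sup (level F s)); split; first exact: ub.
    rewrite le_measure ?inE//; first exact: measurable_level.
    by move=> t Lt; have /FsM := Lt; rewrite /= !in_itv/= => /andP[-> _]; rewrite ub.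
  move=> e e0; have [t Lt te] := sup_adherent e0 hs.
  by exists t => //; split => //; have /FsM := Lt; rewrite /= in_itv/= => /andP[].
have [a [a0 ma aP]] := key f (fun t tM => (fgM t tM).1) f1 mf.
have [b [b0 mb bP]] := key g (fun t tM => (fgM t tM).2) g1 mg.
apply: (@le_trans _ _ ((1 - l)%R%:E * m `[0%R, a]%classic + l%:E * m `[0%R, b]%classic)%E).
  by apply: leeD; apply: lee_wpmul2l => //; rewrite lee_fin ltW.
apply: (le_trans (conc a b l a0 b0 l01)).
set c := (1 - l) * a + l * b.
have c0 : 0 <= c by rewrite addr_ge0// mulr_ge0// ltW.
(* The suprema [a] and [b] need not be attained, so only points strictly below [c] are reached; the
   end point is a null set. *)
have -> : m `[0%R, c]%classic = m (`[0%R, c[%classic : set RB).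
  have -> : `[0%R, c]%classic = `[0%R, c[%classic `|` [set c] :> set R.
    by rewrite setUitv1// bnd_simp.
  rewrite measureU//; first by rewrite [X in (_ + X)%E]atom adde0.
  by apply/seteqP; split => t // -[]; rewrite /= in_itv/= => /andP[_ tc] tE;
    rewrite tE ltxx in tc.
rewrite le_measure ?inE//; first exact: measurable_level.
move=> t; rewrite /= in_itv/= => /andP[t0 tc]; split => //.
have [x [_ fx] [x0 xa]] : exists2 x, level f s x & 0 <= x /\ a - (c - t) < x.
  by apply: aP; rewrite subr_gt0.
have [y [_ gy] [y0 yb]] : exists2 y, level g s y & 0 <= y /\ b - (c - t) < y.
  by apply: bP; rewrite subr_gt0.
apply: (le_trans (H s x y s0 s1 x0 y0 fx gy)); apply: nh => //.
rewrite ltW// -subr_gt0.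
rewrite (_ : _ - t = (1 - l) * (x - (a - (c - t))) + l * (y - (b - (c - t)))).
  by rewrite addr_gt0// mulr_gt0// subr_gt0.
by rewrite /c; ring.
Qed.

End OneDimensionalBM.

Section BrunnMinkowskiStep.
Context {R : realType}.
Local Notation RB := (measurableTypeR R).
Variable m : {sigma_finite_measure set RB -> \bar R}.
Hypothesis cm : concave_distribution m.

(* [a ^+ p] is the maximum of [f]. When it is 0, [F] is the indicator of the
   origin, a null set, so that vanishing fibres need no separate treatment. *)
Lemma exists_normalization (f : RB -> \bar R) (D : set R) (M : R) (p : nat) :
  measurable_fun setT f -> (forall t, 0 <= f t)%E ->
  D 0 -> (forall t, D t -> 0 <= t <= M) ->
  (forall t, ~ D t -> f t = 0%E) -> (forall t, f t <= f 0%R)%E ->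
  (f 0%R < +oo)%E -> (p = 0%N -> forall t, D t -> f t = 1%E) ->
  exists a : R, exists F : RB -> \bar R,
  [/\ 0 <= a /\ (p = 0%N -> a = 1),
      [/\ measurable_fun setT F, forall t, (0 <= F t <= 1)%E, F 0 = 1%E &
        forall t, ~~ (0 <= t <= M) -> F t = 0%E],
      forall r t, 0 < r -> (r%:E <= F t)%E ->
        D t /\ ((r * a ^+ p)%:E <= f t)%E
    & forall w, 0 <= w -> ((w ^+ p.+1)%:E <= \int[m]_t f t)%E ->
        a * (w / a) = w /\ ((a * (w / a) ^+ p.+1)%:E <= \int[m]_t F t)%E].
Proof.
move=> mf f0 D0 DM fD ff foo fp.
have [_ atom _] := cm.
have fin0 : f 0 \is a fin_num by rewrite ge0_fin_numE.
have [a [a0 fa ap]] : exists a, [/\ 0 <= a, f 0 = (a ^+ p)%:E & p = 0%N -> a = 1].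
  have [p0|p0] := posnP p; first by exists 1; rewrite fp// p0 expr0.
  exists (fine (f 0) `^ (p%:R^-1)); split; first exact: powR_ge0.
    by rewrite powRinvK// ?fine_ge0// fineK.
  by move=> p0'; rewrite p0' in p0.
have [a00|an0] := eqVneq a 0.
  have p0 : (0 < p)%N.
    by rewrite lt0n; apply/eqP => /ap/eqP; rewrite a00 eq_sym oner_eq0.
  have fz t : f t = 0%E.
    apply/le_anti; rewrite f0 andbT (le_trans (ff t))//.
    by rewrite fa a00 expr0n gtn_eqF.
  exists a; exists (fun t => (\1_[set 0 : RB] t)%:E); split => //.
  - split.
    + by apply/measurable_EFinP; exact: measurable_indic.
    + by move=> t; rewrite !lee_fin indicE; case: (_ \in _); rewrite /= ?lexx ?ler01.
    + by rewrite indicE mem_set.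
    + move=> t tM; rewrite indicE memNset//= => t0.
      by move: tM; rewrite t0; apply/negP/negPn/DM.
  - move=> r t r0; rewrite indicE lee_fin.
    have [->|/eqP t0] := pselect (t = 0).
      by move=> _; split => //; rewrite a00 expr0n gtn_eqF//= mulr0 fz.
    by rewrite memNset; [rewrite /= leNgt r0|exact/eqP].
  - move=> w w0; rewrite integral0_eq// lee_fin => wp.
    have -> : w = 0.
      by apply/eqP; rewrite -[_ == 0]andTb -(expf_eq0 w p.+1) eq_le wp exprn_ge0.
    split; first by rewrite a00 !mul0r.
    by rewrite a00 mul0r; apply: integral_ge0 => t _; rewrite lee_fin.
have ap0 : 0 < a ^+ p by rewrite exprn_gt0// lt_neqAle eq_sym an0.
have pos : (0 <= ((a ^+ p)^-1)%:E)%E by rewrite lee_fin invr_ge0 ltW.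
exists a; exists (fun t => ((a ^+ p)^-1)%:E * f t)%E; split => //.
- split.
  + exact: measurable_funeM.
  + move=> t; rewrite mule_ge0//= (le_trans (lee_wpmul2l pos (ff t)))//.
    by rewrite fa -EFinM mulVf// gt_eqF.
  + by rewrite fa -EFinM mulVf// gt_eqF.
  + by move=> t tM; rewrite fD ?mule0// => /DM; exact/negP.
- move=> r t r0 rf.
  have H : ((r * a ^+ p)%:E <= f t)%E.
    have -> : f t = ((a ^+ p)%:E * (((a ^+ p)^-1)%:E * f t))%E.
      by rewrite muleA -EFinM divff ?mul1e// gt_eqF.
    by rewrite EFinM muleC lee_pmul2l.
  split => //; apply: contrapT => /fD ft; move: H; rewrite ft lee_fin.
  by rewrite leNgt mulr_gt0.
- move=> w w0 wf; rewrite mulrC divfK//; split => //.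
  rewrite ge0_integralZl// (_ : a * _ = (a ^+ p)^-1 * w ^+ p.+1).
    by rewrite EFinM; apply: lee_wpmul2l.
  by rewrite exprMn exprVn [a ^+ p.+1]exprS invfM mulrCA mulVKf// mulrC.
Qed.

(** One coordinate of the induction: [f], [g], [h] are fibre volumes of dimension [p]. Dividing them
    by a^p, b^p and N^p, where N = (1 - l) a + l b, brings them under [distrib_superadditive];
    convexity turns the resulting linear inequality into one for (p + 1)-st powers. *)
Lemma integral_fiberwise_BM (f g h : RB -> \bar R) (D0 D1 : set R) (l M : R)
    (p : nat) :
  0 < l < 1 ->
  measurable_fun setT f -> measurable_fun setT g -> measurable_fun setT h ->
  (forall t, 0 <= f t)%E -> (forall t, 0 <= g t)%E -> (forall t, 0 <= h t)%E ->
  D0 0 -> D1 0 ->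
  (forall t, D0 t -> 0 <= t <= M) -> (forall t, D1 t -> 0 <= t <= M) ->
  (forall t, ~ D0 t -> f t = 0%E) -> (forall t, ~ D1 t -> g t = 0%E) ->
  (forall t, f t <= f 0%R)%E -> (forall t, g t <= g 0%R)%E ->
  (f 0%R < +oo)%E -> (g 0%R < +oo)%E ->
  (p = 0%N -> forall t, D0 t -> f t = 1%E) ->
  (p = 0%N -> forall t, D1 t -> g t = 1%E) ->
  (forall t t', 0 <= t -> t <= t' -> (h t' <= h t)%E) ->
  (forall t t' u v, D0 t -> D1 t' -> 0 <= u -> 0 <= v ->
    ((u ^+ p)%:E <= f t)%E -> ((v ^+ p)%:E <= g t')%E ->
    ((((1 - l) * u + l * v) ^+ p)%:E <= h ((1 - l) * t + l * t')%R)%E) ->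
  forall u v, 0 <= u -> 0 <= v ->
    ((u ^+ p.+1)%:E <= \int[m]_t f t)%E -> ((v ^+ p.+1)%:E <= \int[m]_t g t)%E ->
    ((((1 - l) * u + l * v) ^+ p.+1)%:E <= \int[m]_t h t)%E.
Proof.
move=> l01 mf mg mh f0 g0 h0 D00 D10 D0M D1M fD gD ff gg foo goo fp gp nh H u v u0 v0 uf vg.
have /andP[l0 l1] := l01; have l'0 : 0 < 1 - l by rewrite subr_gt0.
have [a [F [[a0 ap] [mF F01 F1 FM] Ff Fint]]] :=
  exists_normalization mf f0 D00 D0M fD ff foo fp.
have [b [G [[b0 bp] [mG G01 G1 GM] Gg Gint]]] :=
  exists_normalization mg g0 D10 D1M gD gg goo gp.
have [aua uF] := Fint u u0 uf; have [bvb vG] := Gint v v0 vg.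
set x := u / a in aua uF; set y := v / b in bvb vG.
have x0 : 0 <= x by rewrite divr_ge0.
have y0 : 0 <= y by rewrite divr_ge0.
pose N := (1 - l) * a + l * b.
have N0 : 0 <= N by rewrite addr_ge0// mulr_ge0// ltW.
have [Nz|Nn0] := eqVneq N 0.
  have -> : (1 - l) * u + l * v = 0.
    move/eqP: Nz; rewrite paddr_eq0 ?mulr_ge0 ?(ltW l0) ?(ltW l'0)//.
    rewrite !mulf_eq0 (gt_eqF l0) (gt_eqF l'0) /= => /andP[/eqP az /eqP bz].
    by rewrite -aua -bvb az bz !mul0r !mulr0 addr0.
  by rewrite expr0n/= integral_ge0.
have Np : 0 < N ^+ p by rewrite exprn_gt0// lt_neqAle eq_sym Nn0.
have posN : (0 <= ((N ^+ p)^-1)%:E)%E by rewrite lee_fin invr_ge0 ltW.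
pose K t := (((N ^+ p)^-1)%:E * h t)%E.
have FGK : ((1 - l)%R%:E * \int[m]_t F t + l%:E * \int[m]_t G t <= \int[m]_t K t)%E.
  apply: (distrib_superadditive (M := M) cm l01 mF mG) => //.
  - exact: measurable_funeM.
  - by move=> t; rewrite /K mule_ge0.
  - by move=> t tM; split; [exact: FM|exact: GM].
  - by move=> t t' t0 tt'; rewrite lee_wpmul2l// nh.
  - move=> r t t' r0 r1 t0 t'0 rF rG.
    have [Dt rf] := Ff r t r0 rF; have [Dt' rg] := Gg r t' r0 rG.
    (* A radius [q] for the height [r]; for p = 0 it is 1, which works because r <= 1. *)
    have [q q0 [rq]] : exists2 q, 0 <= q & r <= q ^+ p /\
        (((q * a) ^+ p)%:E <= f t)%E /\ (((q * b) ^+ p)%:E <= g t')%E.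
      have [p0|p0] := posnP p.
        by exists 1 => //; rewrite p0 !expr0; split=> //; rewrite fp// gp.
      exists (r `^ (p%:R^-1)); first exact: powR_ge0.
      by rewrite !exprMn powRinvK// ltW.
    move=> [qa qb].
    have := H t t' (q * a) (q * b) Dt Dt' (mulr_ge0 q0 a0) (mulr_ge0 q0 b0) qa qb.
    rewrite (_ : _ + _ = q * N); last by rewrite /N; ring.
    move=> qNh; apply: (@le_trans _ _ (((N ^+ p)^-1)%:E * ((q * N) ^+ p)%:E)%E).
      by rewrite -EFinM lee_fin exprMn mulrC mulfK// gt_eqF.
    exact: lee_wpmul2l.
have -> : (\int[m]_t h t = (N ^+ p)%:E * \int[m]_t K t)%E.
  by rewrite ge0_integralZl// muleA -EFinM divff ?mul1e// gt_eqF.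
apply: (@le_trans _ _ ((N ^+ p)%:E *
    ((1 - l) * (a * x ^+ p.+1) + l * (b * y ^+ p.+1))%R%:E)%E); last first.
  apply: lee_wpmul2l; first by rewrite lee_fin ltW.
  apply: le_trans FGK; rewrite EFinD (EFinM (1 - l)) (EFinM l).
  by apply: leeD; apply: lee_wpmul2l; rewrite ?lee_fin// ltW.
rewrite -EFinM lee_fin.
(* The weights (1 - l) a / N and l b / N have sum 1 and average x = u / a and y = v / b to ((1 - l)
   u + l v) / N. *)
have := @convex_exprn _ p.+1 ((1 - l) * a / N) (l * b / N) x y.
have -> : (1 - l) * a / N * x + l * b / N * y = ((1 - l) * u + l * v) / N.
  by rewrite -aua -bvb; ring.
rewrite !mulr_ge0 ?invr_ge0 ?(ltW l0) ?(ltW l'0)// -mulrDl divff//.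
move=> /(_ isT isT erefl isT isT); rewrite exprMn exprVn.
rewrite ler_pdivrMr; last by rewrite exprS mulr_gt0// lt_neqAle eq_sym Nn0.
move=> /le_trans; apply; rewrite [N ^+ p.+1]exprS.
have E (X Y Z W : R) : W != 0 -> ((1 - l) * a / W * X + l * b / W * Y) * (W * Z) =
    Z * ((1 - l) * (a * X) + l * (b * Y)) by move=> W0; field.
by rewrite E.
Qed.

End BrunnMinkowskiStep.

(** * Concavity and symmetry of the coordinate measures *)

Section Densities.
Context {R : realType}.
Local Notation RB := (measurableTypeR R).
Local Notation leb := (@lebesgue_measure R).

Lemma sigma_finite_measureP d (T : measurableType d)
    (m : {measure set T -> \bar R}) : sigma_finite setT m ->
  exists Q : {sigma_finite_measure set T -> \bar R}, m = Q :> (set _ -> _).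
Proof.
case: m => f cf sM.
pose Q : {sigma_finite_measure set T -> \bar R} :=
  HB.pack f cf (@Measure_isSigmaFinite.Build _ _ R (Measure.sort (Measure.Pack cf)) sM).
by exists Q.
Qed.

Variable m : {measure set RB -> \bar R}.
Hypothesis dm : even_decreasing_density m.

Lemma even_decreasing_itv_fin (a b : R) : (m `[a, b]%classic < +oo)%E.
Proof.
have [phi [phi0 intphi _ _ mE]] := dm.
rewrite mE//; have /integrableP[_] := intphi _ (@segment_compact _ a b).
by under eq_integral do rewrite gee0_abs//.
Qed.

Lemma even_decreasing_sigma_finite :
  exists Q : {sigma_finite_measure set RB -> \bar R}, m = Q :> (set _ -> _).
Proof.
apply: sigma_finite_measureP.
exists (fun n : nat => `[- n%:R, n%:R]%classic).
  apply/seteqP; split => // x _; exists (Num.bound `|x|) => //=.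
  by rewrite in_itv/= -ler_norml ltW// archi_boundP.
by move=> n; split => //; exact: even_decreasing_itv_fin.
Qed.

(** Let c be the combination of a < b. The density is at least phi(c) on (a, c] and at most phi(c)
    on (c, b], and these lengths are l (b - a) and (1 - l)(b - a); hence (1 - l) m(a, c] is at least
    l m(c, b]. *)
Lemma even_decreasing_concave : concave_distribution m.
Proof.
have [phi [phi0 intphi _ dphi mE]] := dm.
have fin := even_decreasing_itv_fin.
split => [c|c|a b l]; first exact: fin.
  by rewrite mE// integral_set1.
wlog ab : a b l / a <= b => [H|].
  have [ab|/ltW ba] := leP a b; first exact: H.
  move=> a0 b0 /andP[l0 l1]; have := H b a (1 - l) ba b0 a0.
  rewrite subKr addeC (addrC (l * b)); apply.
  by rewrite subr_gt0 l1 gtrBl.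
move=> a0 b0 l01; have /andP[l0 l1] := l01.
have l'0 : 0 < 1 - l by rewrite subr_gt0.
move: ab; rewrite le_eqVlt => /predU1P[<-|ab].
  rewrite -mulrDl subrK mul1r -ge0_muleDl; [|exact/ltW|exact/ltW].
  by rewrite -EFinD subrK mul1e lexx.
set c := (1 - l) * a + l * b.
have ca : c - a = l * (b - a) by rewrite /c; ring.
have bc : b - c = (1 - l) * (b - a) by rewrite /c; ring.
have ac : a < c by rewrite -subr_gt0 ca mulr_gt0// subr_gt0.
have cb : c < b by rewrite -subr_gt0 bc mulr_gt0// subr_gt0.
have c0 : 0 < c by exact: le_lt_trans ac.
have mphi (x y : R) : measurable_fun (`[x, y]%classic : set RB) phi.
  by have /integrableP[] := intphi _ (@segment_compact _ x y).
have mphi' (x y : R) : measurable_fun (`]x, y]%classic : set RB) phi.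
  by apply: measurable_funS (mphi x y) => //; exact: subset_itv_oc_cc.
have split_itv (x y : R) : 0 <= x -> x < y ->
    m `[0%R, y]%classic = (m `[0%R, x]%classic + m (`]x, y]%classic : set RB))%E.
  move=> x0 xy; rewrite -measureU//.
    by rewrite -itv_bndbnd_setU// bnd_simp// ltW.
  apply/seteqP; split => t // -[]; rewrite /= !in_itv/= => /andP[_ tx] /andP[xt _].
  by move: xt; rewrite ltNge tx.
have finoc (x y : R) : (m (`]x, y]%classic : set RB) < +oo)%E.
  apply: le_lt_trans (fin x y); rewrite le_measure ?inE//.
  exact: subset_itv_oc_cc.
have ge_itv (x : R) : 0 <= x -> x < c ->
    (phi c * (c - x)%:E <= m (`]x, c]%classic : set RB))%E.
  move=> x0 xc; rewrite mE//.
  rewrite -[X in (_ * X)%E](_ : leb `]x, c]%classic = _).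
    rewrite -integral_cst//; apply: ge0_le_integral => //.
      by move=> t _; exact: phi0.
    by move=> t; rewrite /= in_itv/= => /andP[xt tc]; rewrite dphi// (le_trans x0)// ltW.
  by rewrite lebesgue_measure_itv/= lte_fin xc EFinB.
(* A pole can sit only at 0: phi(c) c is at most the finite measure of (0, c]. *)
have phic : phi c \is a fin_num.
  rewrite ge0_fin_numE//.
  have := le_lt_trans (ge_itv 0 (lexx _) c0) (finoc 0 c).
  rewrite subr0; case: (phi c) (phi0 c) => [r _|_|//]; first by move=> _; rewrite ltry.
  by rewrite gt0_mulye ?lte_fin// ltxx.
pose q := fine (phi c).
have qE : phi c = q%:E by rewrite fineK.
have ce := ge_itv a a0 ac.
have de : (m (`]c, b]%classic : set RB) <= (q * (b - c))%:E)%E.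
  rewrite mE// EFinM -qE.
  rewrite -[X in (_ * X)%E](_ : leb `]c, b]%classic = _).
    rewrite -integral_cst//; apply: ge0_le_integral => //.
    by move=> t; rewrite /= in_itv/= => /andP[ct tb]; rewrite dphi// ltW.
  by rewrite lebesgue_measure_itv/= lte_fin cb EFinB.
move: ce; rewrite qE (split_itv c b (ltW c0) cb) (split_itv a c a0 ac).
have fA : m `[0%R, a]%classic \is a fin_num by rewrite ge0_fin_numE.
have fC : m (`]a, c]%classic : set RB) \is a fin_num by rewrite ge0_fin_numE.
have fD : m (`]c, b]%classic : set RB) \is a fin_num by rewrite ge0_fin_numE.
move: de; rewrite -(fineK fA) -(fineK fC) -(fineK fD).
set D := fine _; set C := fine _; set A := fine _.
rewrite -!EFinD -!EFinM !lee_fin ca bc => de ce.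
rewrite -subr_ge0.
have h1 : l * D <= l * (q * ((1 - l) * (b - a))) by rewrite ler_wpM2l// ltW.
have h2 : (1 - l) * (q * (l * (b - a))) <= (1 - l) * C by rewrite ler_wpM2l// ltW.
rewrite (_ : _ - _ = ((1 - l) * C - (1 - l) * (q * (l * (b - a)))) +
   (l * (q * ((1 - l) * (b - a))) - l * D)); last by ring.
by rewrite addr_ge0// subr_ge0.
Qed.

Lemma even_decreasing_sym (S : set RB) : measurable S ->
  m ((-%R : R -> R) @^-1` S) = m S.
Proof.
have [phi [phi0 intphi ephi dphi mE]] := dm.
move=> mS.
have mphi : measurable_fun (setT : set RB) phi.
  rewrite (_ : setT = \bigcup_n (`[- n%:R, n%:R]%classic : set RB)).
    apply/measurable_fun_bigcup => // n.
    by have /integrableP[] := intphi _ (@segment_compact _ (- n%:R) n%:R).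
  apply/seteqP; split => // x _; exists (Num.bound `|x|) => //=.
  by rewrite in_itv/= -ler_norml ltW// archi_boundP.
have mopp : measurable_fun (setT : set RB) (-%R : RB -> RB) by exact: oppr_measurable.
have mNS : measurable ((-%R : RB -> RB) @^-1` S).
  by rewrite -[X in measurable X]setTI; exact: mopp.
rewrite !mE//.
transitivity (\int[pushforward leb (-%R : RB -> RB)]_(x in S) phi x)%E.
  rewrite ge0_integral_pushforward//; last exact: measurable_funS mphi.
  by apply: eq_integral => x _ /=; rewrite ephi.
apply: eq_measure_integral => //= A mA AS; exact: lebesgue_measureN.
Qed.

End Densities.

(** * Iterated integrals over coordinates *)

Section CoordinateIntegrals.
Context {R : realType} {n : nat}.
Local Notation RB := (measurableTypeR R).
Local Notation T := (n.-tuple RB).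
Variable m : 'I_n -> {sigma_finite_measure set RB -> \bar R}.
Implicit Types (x y z : T) (k : 'I_n) (s : seq 'I_n) (F G : T -> \bar R).

Definition upd x k (v : RB) : T :=
  [tuple if i == k then v else tnth x i | i < n].

Lemma tnth_upd x k v i : tnth (upd x k v) i = if i == k then v else tnth x i.
Proof. by rewrite tnth_mktuple. Qed.

Lemma updC x k l v w : k != l -> upd (upd x k v) l w = upd (upd x l w) k v.
Proof.
move=> kl; apply: eq_from_tnth => i; rewrite !tnth_upd.
by have [->|//] := eqVneq i l; rewrite eq_sym (negbTE kl).
Qed.

Lemma measurable_upd k : measurable_fun setT (fun p : T * RB => upd p.1 k p.2).
Proof.
apply/measurable_fun_tnthP => i.
have [->|ik] := eqVneq i k.
  rewrite (_ : _ \o _ = snd); first exact: measurable_snd.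
  by apply/funext => p /=; rewrite tnth_upd eqxx.
rewrite (_ : _ \o _ = (fun t : T => tnth t i) \o fst).
  by apply: measurableT_comp; [exact: measurable_tnth|exact: measurable_fst].
by apply/funext => p /=; rewrite tnth_upd (negbTE ik).
Qed.

(** Partial integrals stay functions on the whole space, constant in the integrated coordinates, so
    that sections over different coordinate sets are comparable without a change of type. *)
Definition Iop k F x : \bar R := (\int[m k]_t F (upd x k t))%E.

Definition Iops s F : T -> \bar R := foldr Iop F s.

Section measurable_ge0.
Variable F : T -> \bar R.
Hypotheses (mF : measurable_fun setT F) (F0 : forall x, (0 <= F x)%E).

Lemma measurable_upd_pair k :
  measurable_fun setT (fun p : T * RB => F (upd p.1 k p.2)).
Proof. exact: (measurableT_comp mF (measurable_upd k)). Qed.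

Lemma measurable_upd_fiber k x : measurable_fun setT (fun t : RB => F (upd x k t)).
Proof. exact: (measurableT_comp (measurable_upd_pair k) (measurable_pair1 x)). Qed.

Lemma Iop_ge0 k x : (0 <= Iop k F x)%E.
Proof. exact: integral_ge0. Qed.

Lemma measurable_Iop k : measurable_fun setT (Iop k F).
Proof.
exact: (@measurable_fun_fubini_tonelli_F _ _ _ _ _ (m k) _ (measurable_upd_pair k)).
Qed.

End measurable_ge0.

Lemma Iops_measurable_ge0 s F : measurable_fun setT F -> (forall x, (0 <= F x)%E) ->
  measurable_fun setT (Iops s F) /\ (forall x, (0 <= Iops s F x)%E).
Proof.
move=> mF F0; elim: s => [|k s [mI I0]]//=; split; first exact: measurable_Iop.
by move=> x; exact: Iop_ge0.
Qed.

Lemma measurable_Iops s F : measurable_fun setT F -> (forall x, (0 <= F x)%E) ->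
  measurable_fun setT (Iops s F).
Proof. by move=> mF F0; have [] := Iops_measurable_ge0 s mF F0. Qed.

Lemma Iops_ge0 s F x : measurable_fun setT F -> (forall x, (0 <= F x)%E) ->
  (0 <= Iops s F x)%E.
Proof. by move=> mF F0; have [] := Iops_measurable_ge0 s mF F0. Qed.

Lemma Iops_cat s1 s2 F : Iops (s1 ++ s2) F = Iops s1 (Iops s2 F).
Proof. by rewrite /Iops foldr_cat. Qed.

Lemma Iop_comm k l F : k != l -> measurable_fun setT F -> (forall x, (0 <= F x)%E) ->
  Iop k (Iop l F) = Iop l (Iop k F).
Proof.
move=> kl mF F0; apply/funext => x; rewrite /Iop.
pose h (p : RB * RB) := F (upd (upd x k p.1) l p.2).
have mh : measurable_fun setT h.
  have mp : measurable_fun setT (fun p : RB * RB => (upd x k p.1, p.2)).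
    apply: measurable_fun_pair; last exact: measurable_snd.
    have := measurableT_comp (measurable_upd k) (measurable_pair1 x).
    by move=> /measurableT_comp; apply; exact: measurable_fst.
  exact: (measurableT_comp (measurable_upd_pair mF l) mp).
transitivity (\int[m l]_u \int[m k]_t h (t, u))%E.
  exact: (@fubini_tonelli _ _ _ _ _ (m k) (m l) h mh (fun p => F0 _)).
by apply: eq_integral => t _; apply: eq_integral => u _; rewrite /h updC.
Qed.

Lemma Iop_Iops_comm k s F : k \notin s -> measurable_fun setT F ->
  (forall x, (0 <= F x)%E) -> Iop k (Iops s F) = Iops s (Iop k F).
Proof.
move=> + mF F0; elim: s => // l s IH; rewrite inE negb_or => /andP[kl ks] /=.
by rewrite Iop_comm ?IH//; [exact: measurable_Iops|move=> x; exact: Iops_ge0].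
Qed.

Lemma perm_Iops s1 s2 F : uniq s1 -> perm_eq s1 s2 -> measurable_fun setT F ->
  (forall x, (0 <= F x)%E) -> Iops s1 F = Iops s2 F.
Proof.
move=> + + mF F0; elim: s1 s2 => [|k s1 IH] s2 /=.
  by move=> _; rewrite perm_sym => /perm_nilP ->.
move=> /andP[ks1 us1] p12.
have ks2 : k \in s2 by rewrite -(perm_mem p12) mem_head.
have us2 : uniq s2 by rewrite -(perm_uniq p12)/= ks1.
case/splitPr: ks2 p12 us2 => q1 q2 p12.
rewrite cat_uniq/= => /and4P[_ /norP[kq1 _] _ _].
rewrite (IH (q1 ++ q2))//; last first.
  by rewrite -(perm_cons k) (perm_trans p12)// perm_sym -cat1s perm_catCA.
rewrite !Iops_cat/= Iop_Iops_comm//; first exact: measurable_Iops.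
by move=> x; exact: Iops_ge0.
Qed.

(** With two base points the lemma covers monotonicity both in the integrand and in the fixed
    coordinates. *)
Lemma Iops_le s F G x y : measurable_fun setT F -> (forall x, (0 <= F x)%E) ->
  measurable_fun setT G -> (forall x, (0 <= G x)%E) ->
  (forall z w, (forall i, i \in s -> tnth z i = tnth w i) ->
     (forall i, i \notin s -> tnth z i = tnth x i /\ tnth w i = tnth y i) ->
     (F z <= G w)%E) ->
  (Iops s F x <= Iops s G y)%E.
Proof.
move=> mF F0 mG G0; elim: s x y => [|k s IH] x y H /=; first exact: H.
apply: ge0_le_integral => //.
- by move=> t _; exact: Iops_ge0.
- by apply: measurable_upd_fiber; exact: measurable_Iops.
- by apply: measurable_upd_fiber; exact: measurable_Iops.
move=> t _; apply: IH => z w zw zxy; apply: H.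
  move=> i; rewrite inE => /predU1P[->|]; last exact: zw.
  have [/zw//|/zxy] := boolP (k \in s).
  by rewrite !tnth_upd eqxx => -[-> ->].
move=> i; rewrite inE negb_or => /andP[ik /zxy].
by rewrite !tnth_upd (negbTE ik).
Qed.

Lemma eq_Iops s F G x : measurable_fun setT F -> (forall x, (0 <= F x)%E) ->
  measurable_fun setT G -> (forall x, (0 <= G x)%E) ->
  (forall z, (forall i, i \notin s -> tnth z i = tnth x i) -> F z = G z) ->
  Iops s F x = Iops s G x.
Proof.
move=> mF F0 mG G0 H; apply/le_anti/andP; split; apply: Iops_le => // z w zw zx.
  have -> : z = w.
    apply: eq_from_tnth => i; have [/zw//|/zx[-> ->]//] := boolP (i \in s).
  by rewrite H// => i /zx[].
have -> : z = w.
  apply: eq_from_tnth => i; have [/zw//|/zx[-> ->]//] := boolP (i \in s).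
by rewrite H// => i /zx[].
Qed.

Lemma Iops_eq0 s F x : measurable_fun setT F -> (forall x, (0 <= F x)%E) ->
  (forall z, (forall i, i \notin s -> tnth z i = tnth x i) -> F z = 0%E) ->
  Iops s F x = 0%E.
Proof.
move=> mF F0 H; rewrite (@eq_Iops s F (cst 0%E))//.
elim: s {H} x => //= k s IH x.
by rewrite /Iop integral0_eq.
Qed.

Lemma IopsZl s F (c : \bar R) x : (0 <= c)%E ->
  measurable_fun setT F -> (forall x, (0 <= F x)%E) ->
  Iops s (fun z => c * F z)%E x = (c * Iops s F x)%E.
Proof.
move=> c0 mF F0; elim: s x => //= k s IH x; rewrite /Iop.
under eq_integral do rewrite IH.
rewrite ge0_integralZl//; first by apply: measurable_upd_fiber; exact: measurable_Iops.
by move=> t _; exact: Iops_ge0.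
Qed.

End CoordinateIntegrals.

(** * Volumes of sections of down-closed sets *)

Section Downsets.
Context {R : realType} {n : nat}.
Local Notation RB := (measurableTypeR R).
Local Notation T := (n.-tuple RB).
Variable m : 'I_n -> {sigma_finite_measure set RB -> \bar R}.
Hypothesis cm : forall k, concave_distribution (m k).
Variable M : R.
Implicit Types (x y z : T) (k : 'I_n) (s : seq 'I_n) (F G : T -> \bar R).
Implicit Types (K : set T).

Definition origin : T := [tuple 0 | i < n].

Lemma tnth_origin i : tnth origin i = 0.
Proof. by rewrite tnth_mktuple. Qed.

Definition zero_on (D : {pred 'I_n}) x := forall i, i \in D -> tnth x i = 0.

Definition bounded_downset K : Prop :=
  [/\ measurable K, forall x i, K x -> 0 <= tnth x i <= M
    & forall x y, K x -> (forall i, 0 <= tnth y i <= tnth x i) -> K y].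

Definition ind K : T -> \bar R := fun x => (\1_K x)%:E.

Lemma measurable_ind K : measurable K -> measurable_fun setT (ind K).
Proof. by move=> mK; apply/measurable_EFinP; exact: measurable_indic. Qed.

Lemma ind_ge0 K x : (0 <= ind K x)%E.
Proof. by rewrite lee_fin. Qed.

Lemma ind1 K x : K x -> ind K x = 1%E.
Proof. by move=> Kx; rewrite /ind indicE mem_set. Qed.

Lemma ind0 K x : ~ K x -> ind K x = 0%E.
Proof. by move=> Kx; rewrite /ind indicE memNset. Qed.

Definition vol s K : T -> \bar R := Iops m s (ind K).

Section OneDownset.
Variable K : set T.
Hypothesis dK : bounded_downset K.

Let mK : measurable_fun setT (ind K).
Proof. by case: dK => mK _ _; exact: measurable_ind. Qed.

Lemma measurable_vol s : measurable_fun setT (vol s K).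
Proof. by apply: measurable_Iops => //; exact: ind_ge0. Qed.

Lemma vol_ge0 s x : (0 <= vol s K x)%E.
Proof. by apply: Iops_ge0 => //; exact: ind_ge0. Qed.

(** A point of [K] with the coordinates of [x] outside [s] dominates [x], which is 0 on [s]; so an
    [x] outside [K] has an empty fibre. *)
Lemma vol_notin s x : zero_on (mem s) x -> ~ K x -> vol s K x = 0%E.
Proof.
move=> xs Kx; apply: Iops_eq0 => //; first exact: ind_ge0.
move=> z zx; apply: ind0 => Kz; apply: Kx; have [_ Kb Kd] := dK.
apply: (Kd z) => // i; have /andP[zi _] := Kb z i Kz.
by have [/xs ->|/zx <-] := boolP (i \in s); rewrite ?lexx zi.
Qed.

Lemma vol_nincr s x y : (forall i, i \notin s -> 0 <= tnth x i <= tnth y i) ->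
  (vol s K y <= vol s K x)%E.
Proof.
move=> xy; apply: Iops_le => //; try exact: ind_ge0.
move=> z w zw zxy; have [Kz|Kz] := pselect (K z); last by rewrite ind0// ind_ge0.
have [_ Kb Kd] := dK.
rewrite !ind1//; apply: (Kd z) => // i.
have [/zw <-|si] := boolP (i \in s).
  by have /andP[-> _] := Kb z i Kz; rewrite lexx.
by have [-> ->] := zxy i si; exact: xy.
Qed.

Lemma vol_upd_out s k x t : k \notin s -> ~~ (0 <= t <= M) ->
  vol s K (upd x k t) = 0%E.
Proof.
move=> ks tM; apply: Iops_eq0 => //; first exact: ind_ge0.
move=> z zx; apply: ind0 => Kz; have [_ Kb _] := dK.
by have := Kb z k Kz; rewrite zx// tnth_upd eqxx (negbTE tM).
Qed.

Lemma vol_bounded s : uniq s ->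
  exists C : R, 0 <= C /\ forall x, (vol s K x <= C%:E)%E.
Proof.
elim: s => [_|k s IH /= /andP[ks us]].
  exists 1; split => // x; rewrite /vol/= /ind lee_fin indicE.
  by case: (_ \in _); rewrite /= ?ler01.
have [C [C0 hC]] := IH us.
have [fin _ _] := cm k.
exists (C * fine (m k `[0%R, M]%classic)); split.
  by rewrite mulr_ge0// fine_ge0.
move=> x; rewrite EFinM fineK ?ge0_fin_numE//.
apply: (@le_trans _ _ (\int[m k]_(t in `[0%R, M]%classic) (cst C%:E t))%E); last first.
  by rewrite integral_cst.
rewrite [leRHS]integral_mkcond; apply: ge0_le_integral => //.
- by move=> t _; exact: vol_ge0.
- by apply: measurable_upd_fiber; exact: measurable_vol.
- by apply/(measurable_restrictT _ _).1 => //; exact: measurable_cst.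
move=> t _; rewrite patchE mem_setE in_itv/=; case: ifPn => // tM.
by rewrite [leLHS](vol_upd_out x ks tM).
Qed.

Lemma vol_lty s x : uniq s -> (vol s K x < +oo)%E.
Proof.
by move=> /vol_bounded[C [_ hC]]; apply: le_lt_trans (hC x) _; exact: ltry.
Qed.

End OneDownset.

Definition comb (l : R) x y : T :=
  [tuple (1 - l) * tnth x i + l * tnth y i | i < n].

Lemma tnth_comb l x y i : tnth (comb l x y) i = (1 - l) * tnth x i + l * tnth y i.
Proof. by rewrite tnth_mktuple. Qed.

Lemma comb_upd l x y k t u :
  comb l (upd x k t) (upd y k u) = upd (comb l x y) k ((1 - l) * t + l * u).
Proof.
apply: eq_from_tnth => i; rewrite !(tnth_comb, tnth_upd).
by case: eqP.
Qed.

(** Numbers [u] and [v] below the roots of the volumes avoid roots of extended reals. Membership of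
    [x] and [y] expresses that the fibres are nonempty; a volume of 0 would not tell this from an
    empty fibre, for which the inequality can fail. *)
Lemma vol_BM s (K0 K1 K : set T) l : uniq s -> 0 < l < 1 ->
  bounded_downset K0 -> bounded_downset K1 -> bounded_downset K ->
  (forall x y, K0 x -> K1 y -> K (comb l x y)) ->
  forall x y (u v : R), K0 x -> K1 y -> zero_on (mem s) x -> zero_on (mem s) y ->
  0 <= u -> 0 <= v ->
  ((u ^+ size s)%:E <= vol s K0 x)%E -> ((v ^+ size s)%:E <= vol s K1 y)%E ->
  ((((1 - l) * u + l * v) ^+ size s)%:E <= vol s K (comb l x y))%E.
Proof.
move=> + l01 dK0 dK1 dK K01.
have /andP[l0 l1] := l01; have l'0 : 0 < 1 - l by rewrite subr_gt0.
elim: s => [_ x y u v K0x K1y _ _ u0 v0 _ _|k s IH /= /andP[ks us] x y u v K0x K1y xs ys].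
  by rewrite /vol/= ind1//; exact: K01.
have [_ b0 d0] := dK0; have [_ b1 d1] := dK1; have [_ bK ddK] := dK.
have zs (z : T) t : zero_on (mem (k :: s)) z -> zero_on (mem s) (upd z k t).
  move=> zks i si; rewrite tnth_upd; case: eqP => [ik|_].
    by move: ks; rewrite -ik si.
  by apply: zks; rewrite inE si orbT.
have zero_in (D : set T) z : bounded_downset D -> D z -> D (upd z k 0).
  move=> [_ bD dD] Dz; apply: (dD z) => // i; rewrite tnth_upd.
  have /andP[zi _] := bD z i Dz.
  by case: eqP => _; rewrite ?lexx ?zi.
have inM (D : set T) z : bounded_downset D -> forall t, D (upd z k t) -> 0 <= t <= M.
  by move=> [_ bD _] t /(bD _ k); rewrite tnth_upd eqxx.
have vmax (D : set T) z : bounded_downset D -> D z -> zero_on (mem (k :: s)) z ->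
    forall t, (vol s D (upd z k t) <= vol s D (upd z k 0%R))%E.
  move=> dD Dz zks t; have [t0|t0] := leP 0 t; last first.
    by rewrite (vol_upd_out dD z ks)// ?vol_ge0// negb_and -ltNge t0.
  apply: vol_nincr => // i si; rewrite !tnth_upd.
  have [_ bD _] := dD; have /andP[zi _] := bD z i Dz.
  by case: eqP => _; rewrite ?lexx ?zi.
apply: (integral_fiberwise_BM (cm k)
  (D0 := [set t | K0 (upd x k t)]) (D1 := [set t | K1 (upd y k t)]) (M := M) l01).
- by apply: measurable_upd_fiber; exact: measurable_vol.
- by apply: measurable_upd_fiber; exact: measurable_vol.
- by apply: measurable_upd_fiber; exact: measurable_vol.
- by move=> t; exact: vol_ge0.
- by move=> t; exact: vol_ge0.
- by move=> t; exact: vol_ge0.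
- exact: zero_in.
- exact: zero_in.
- exact: inM.
- exact: inM.
- by move=> t K0t; apply: vol_notin => //; exact: zs.
- by move=> t K1t; apply: vol_notin => //; exact: zs.
- exact: vmax.
- exact: vmax.
- exact: vol_lty.
- exact: vol_lty.
- by move=> /size0nil -> t K0t; rewrite /vol/= ind1.
- by move=> /size0nil -> t K1t; rewrite /vol/= ind1.
- move=> t t' t0 tt'; apply: vol_nincr => // i _; rewrite !tnth_upd.
  case: eqP => _; first by rewrite t0 tt'.
  rewrite lexx andbT; have := bK _ i (K01 _ _ K0x K1y).
  by case/andP.
move=> t t' u' v' K0t K1t u'0 v'0 ut vt; rewrite -comb_upd.
by apply: IH => //; exact: zs.
Qed.

End Downsets.

(** * Product measures as iterated integrals *)

Section ProductIntegral.
Context {R : realType} {n : nat}.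
Local Notation RB := (measurableTypeR R).
Local Notation T := (n.-tuple RB).
Variable m : 'I_n -> {sigma_finite_measure set RB -> \bar R}.

Fixpoint upds (x : T) (s : seq 'I_n) (t : seq RB) : T :=
  match s, t with
  | k :: s', v :: t' => upds (upd x k v) s' t'
  | _, _ => x
  end.

Lemma tnth_upds_notin s x t i : i \notin s -> tnth (upds x s t) i = tnth x i.
Proof.
elim: s x t => [|k s IH] x [|v t]//=; rewrite inE negb_or => /andP[ik is_].
by rewrite IH// tnth_upd (negbTE ik).
Qed.

Lemma tnth_upds_in s x t i : uniq s -> size t = size s -> i \in s ->
  tnth (upds x s t) i = nth 0 t (index i s).
Proof.
elim: s x t => [|k s IH] x [|v t]//= /andP[ks us] [st]; rewrite inE.
have [->|ik] := eqVneq i k; first by rewrite tnth_upds_notin// tnth_upd eqxx.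
by move=> /= si; rewrite IH// eq_sym (negbTE ik).
Qed.

Lemma measurable_upds p (e : 'I_p -> 'I_n) :
  measurable_fun setT
    (fun q : T * p.-tuple RB => upds q.1 [seq e j | j <- enum 'I_p] q.2).
Proof.
elim: p e => [|p IH] e.
  rewrite (_ : (fun q => _) = fst); first exact: measurable_fst.
  by apply/funext => q; rewrite (size0nil (size_enum_ord 0)).
have mhd : measurable_fun setT (fun q : T * p.+1.-tuple RB => tnth q.2 ord0).
  by apply: (measurableT_comp (measurable_tnth ord0)); exact: measurable_snd.
have mtl : measurable_fun setT (fun q : T * p.+1.-tuple RB => [tuple of behead q.2]).
  exact: (measurableT_comp (@measurable_behead _ _ _) measurable_snd).
have m1 : measurable_fun setT
    (fun q : T * p.+1.-tuple RB => (upd q.1 (e ord0) (tnth q.2 ord0), [tuple of behead q.2])).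
  apply: measurable_fun_pair => //.
  have m2 : measurable_fun setT (fun q : T * p.+1.-tuple RB => (q.1, tnth q.2 ord0)).
    by apply: measurable_fun_pair => //; exact: measurable_fst.
  exact: (measurableT_comp (measurable_upd (e ord0)) m2).
have := measurableT_comp (IH (fun j => e (lift ord0 j))) m1.
rewrite (_ : _ \o _ = fun q : T * p.+1.-tuple RB =>
  upds q.1 [seq e j | j <- enum 'I_p.+1] q.2)//.
apply/funext => -[x t]/=; rewrite enum_ordSl/= -map_comp.
by case/tupleP: t => v t /=; rewrite (tnth_nth 0)/=.
Qed.

Lemma measurable_upds_at p (e : 'I_p -> 'I_n) x :
  measurable_fun setT
    (fun t : p.-tuple RB => upds x [seq e j | j <- enum 'I_p] t).
Proof. exact: (measurableT_comp (measurable_upds e) (measurable_pair1 x)). Qed.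

(** [prod_measure] and [Iops] both peel off the first coordinate, so each induction step is one use
    of Tonelli's theorem. The map [e] also allows the coordinates of a subspace, and [x] supplies
    the remaining ones. *)
Lemma prod_measure_integral p (e : 'I_p -> 'I_n) :
  exists P : {sigma_finite_measure set (p.-tuple RB) -> \bar R},
    prod_measure (fun j => m (e j)) = P :> (set _ -> _) /\
    forall F x, measurable_fun setT F -> (forall x, (0 <= F x)%E) ->
      (\int[P]_t F (upds x [seq e j | j <- enum 'I_p] t))%E =
      Iops m [seq e j | j <- enum 'I_p] F x.
Proof.
elim: p e => [|p IH] e.
  have [P /= PE] := prod_measure_sigma_finite (fun j : 'I_0 => m (e j)).
  exists P; split => // F x mF F0.
  rewrite (size0nil (size_enum_ord 0))/= -PE/=.
  rewrite integral_dirac//.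
  by rewrite diracT mul1e.
have [P' [P'E P'I]] := IH (fun j => e (lift ord0 j)).
have [Q QE] := prod_measure_cons_sigma_finite (m (e ord0)) P'.
exists Q; split; first by rewrite /= P'E.
move=> F x mF F0; rewrite -QE.
have mG : measurable_fun setT
    (fun t : p.+1.-tuple RB => F (upds x [seq e j | j <- enum 'I_p.+1] t)).
  exact: (measurableT_comp mF (measurable_upds_at e x)).
rewrite (ge0_integral_pushforward (@measurable_cons_pair R p))//.
rewrite preimage_setT fubini_tonelli1//; last 2 first.
- exact: (measurableT_comp mG (@measurable_cons_pair R p)).
- by move=> q; exact: F0.
rewrite enum_ordSl/=; apply: eq_integral => v _.
rewrite /fubini_F/= -map_comp -[in RHS](P'I F (upd x (e ord0) v) mF F0).
by apply: eq_integral => t _; rewrite -map_comp.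
Qed.

End ProductIntegral.

(** * Restricted Loomis--Whitney inequality *)

Section KeyInequality.
Context {R : realType} {n : nat}.
Local Notation RB := (measurableTypeR R).
Local Notation T := (n.-tuple RB).
Variable m : 'I_n -> {sigma_finite_measure set RB -> \bar R}.
Hypothesis cm : forall k, concave_distribution (m k).
Variables (M : R) (K : set T).
Hypothesis dK : bounded_downset M K.
Hypothesis convK : forall l x y, 0 < l < 1 -> K x -> K y -> K (comb l x y).
Hypothesis K0 : K origin.
Local Notation vol := (vol m).

Let K_ge0 x i : K x -> 0 <= tnth x i.
Proof. by have [_ Kb _] := dK; move=> /(Kb x i) /andP[]. Qed.

(** The projections of a fibre of a down-closed set to two groups of coordinates are contained in
    the sections over them, so the fibre lies in the product of these sections. *)
Lemma vol_cat_le s1 s2 (z : T) : zero_on (mem (s1 ++ s2)) z ->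
  (forall i, i \in s1 -> i \notin s2) ->
  (forall i, 0 <= tnth z i) ->
  (vol (s1 ++ s2) K z <= vol s1 K z * vol s2 K z)%E.
Proof.
move=> z12 d12 z0; rewrite /vol Iops_cat -/(vol s2 K).
have [mK _ _] := dK; have mi := measurable_ind mK.
rewrite muleC -IopsZl//; [|exact: (vol_ge0 _ dK)|exact: ind_ge0].
apply: Iops_le.
- exact: (measurable_vol _ dK).
- exact: (vol_ge0 _ dK).
- exact: measurable_funeM.
- by move=> x; rewrite mule_ge0 ?ind_ge0 ?(vol_ge0 _ dK).
move=> x y xy xyz; have -> : x = y.
  by apply: eq_from_tnth => i; have [/xy//|/xyz[-> ->]//] := boolP (i \in s1).
have y2 : zero_on (mem s2) y.
  move=> i i2; have [/d12|/xyz[_ ->]] := boolP (i \in s1); first by move/negP.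
  by apply: z12; rewrite mem_cat; apply/orP; right.
have [Ky|Ky] := pselect (K y); last by rewrite (vol_notin _ dK)// mule_ge0 ?ind_ge0 ?(vol_ge0 _ dK).
rewrite ind1// mule1; apply: (vol_nincr _ dK) => i _.
have [i1|/xyz[_ ->]] := boolP (i \in s1); last by rewrite z0 lexx.
have -> : tnth z i = 0 by apply: z12; rewrite mem_cat i1.
by rewrite lexx K_ge0.
Qed.

Variables (X Y Z : {set 'I_n}).
Hypothesis XY : forall i, i \in X -> i \notin Y.

Lemma measurable_zero_on (D : {pred 'I_n}) : measurable [set x : T | zero_on D x].
Proof.
rewrite (_ : [set x | _] = \big[setI/setT]_(i | i \in D) [set x : T | tnth x i = 0]).
  apply: bigsetI_measurable => i _.
  have := @measurable_tnth _ RB n i measurableT [set 0] (measurable_set1 _).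
  by rewrite setTI.
apply/seteqP; split => [x xD|x].
  by apply: (big_ind (fun A : set T => A x)) => //= A B Ax Bx; split.
move=> + i iD; rewrite (bigD1 i)//= => -[]//.
Qed.

(* The section of [K] by the coordinate subspace of [X], cut down to a superlevel
   set of the fibre volume over [Y]. *)
Definition slice (s : R) (x : T) : Prop :=
  [/\ K x, zero_on [predC X] x & (s%:E <= vol (enum Y) K x)%E].

Lemma slice_downset s : bounded_downset M [set x | slice s x].
Proof.
have [mK Kb Kd] := dK; split.
- rewrite (_ : [set x | _] = K `&` [set x | zero_on [predC X] x] `&`
    [set x | (s%:E <= vol (enum Y) K x)%E]); last first.
    by apply/seteqP; split => x; [move=> []|move=> [[]]].
  apply: measurableI; first by apply: measurableI => //; exact: measurable_zero_on.
  rewrite -[X in measurable X]setTI; apply: measurable_lee => //.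
  exact: (measurable_vol _ dK).
- by move=> x i [Kx _ _]; exact: Kb.
- move=> x y [Kx xX sx] yx; split.
  + exact: Kd Kx yx.
  + move=> i iX; apply/le_anti; have /andP[-> yi] := yx i.
    by rewrite (le_trans yi)// xX.
  + by apply: (le_trans sx); apply: (vol_nincr _ dK).
Qed.

(** [vol_BM] with v = 0: towards a point [y] whose fibre is only known to be nonempty, the radius
    s^(1/|Y|) shrinks by no more than the factor 1 - l. *)
Lemma slice_comb l s t x y : (0 < #|Y|)%N -> 0 < l < 1 -> 0 < s -> t <= (1 - l) ^+ #|Y| * s ->
  slice s x -> K y -> zero_on [predC X] y -> slice t (comb l x y).
Proof.
move=> Y0 l01 s0 ts [Kx xX sx] Ky yX; split; first exact: convK.
  by move=> i iX; rewrite tnth_comb xX// yX// !mulr0 addr0.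
have XcY i : i \in enum Y -> i \in [predC X].
  by rewrite mem_enum => iY; rewrite inE; apply: contraL iY; exact: XY.
have l'0 : 0 <= 1 - l by case/andP: l01 => _ /ltW; rewrite subr_ge0.
have := vol_BM cm (enum_uniq (mem Y)) l01 dK dK dK (fun x y => convK l01)
  Kx Ky (fun i iY => xX i (XcY i iY)) (fun i iY => yX i (XcY i iY))
  (powR_ge0 s (#|Y|%:R^-1)) (lexx 0).
rewrite -cardE powRinvK ?(ltW s0)// mulr0 addr0 exprMn powRinvK ?(ltW s0)//.
move=> /(_ sx); rewrite expr0n gtn_eqF// => /(_ (vol_ge0 _ dK _ _)).
by apply: le_trans; rewrite lee_fin.
Qed.

Lemma map_enum_val (A : {set 'I_n}) : [seq enum_val j | j <- enum 'I_#|A|] = enum A.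
Proof.
have [->|[i0 _]] := set_0Vmem A.
  have e0 : enum (@finset.set0 'I_n) = [::].
    by apply: size0nil; rewrite -cardE cards0.
  rewrite e0; apply: size0nil; rewrite size_map -cardE card_ord.
  exact: cards0.
apply: (@eq_from_nth _ i0); first by rewrite size_map size_enum_ord -cardE.
move=> i; rewrite size_map size_enum_ord => iA.
rewrite (nth_map (Ordinal iA)) ?size_enum_ord// (enum_val_nth i0).
by rewrite nth_enum_ord.
Qed.

Section Levels.
Variable P : {sigma_finite_measure set (#|X|.-tuple RB) -> \bar R}.
Hypothesis PI : forall F x, measurable_fun setT F -> (forall x, (0 <= F x)%E) ->
  (\int[P]_t F (upds x [seq enum_val j | j <- enum 'I_#|X|] t))%E =
  Iops m [seq enum_val j | j <- enum 'I_#|X|] F x.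

Definition lifted (F : T -> \bar R) (t : #|X|.-tuple RB) : \bar R :=
  F (upds origin [seq enum_val j | j <- enum 'I_#|X|] t).

Lemma measurable_lifted F : measurable_fun setT F -> measurable_fun setT (lifted F).
Proof.
move=> mF; exact: (measurableT_comp mF (measurable_upds_at enum_val origin)).
Qed.

Lemma integral_lifted F : measurable_fun setT F -> (forall x, (0 <= F x)%E) ->
  (\int[P]_t lifted F t)%E = Iops m (enum X) F origin.
Proof. by move=> mF F0; rewrite PI// map_enum_val. Qed.

Lemma zero_on_upds t : zero_on [predC X]
  (upds origin [seq enum_val j | j <- enum 'I_#|X|] t : T).
Proof.
move=> i; rewrite inE => iX; rewrite tnth_upds_notin ?tnth_origin//.
by rewrite map_enum_val mem_enum.
Qed.

(** A positive height excludes points outside [K], where the fibre volume is 0; so the level sets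
    are the slices. *)
Lemma distrib_lifted s : 0 < s ->
  distrib P (lifted (vol (enum Y) K)) s = vol (enum X) [set x | slice s x] origin.
Proof.
move=> s0; have [ms _ _] := slice_downset s.
rewrite -[RHS]integral_lifted; [|exact: measurable_ind|exact: ind_ge0].
have mL : measurable (level (lifted (vol (enum Y) K)) s).
  by apply: measurable_level; apply: measurable_lifted; exact: (measurable_vol _ dK).
rewrite /distrib -[X in P X]setIT -[LHS]integral_indic//.
apply: eq_integral => t _; rewrite /lifted /ind !indicE.
set x := upds _ _ _; congr ((nat_of_bool _)%:R%:E).
apply/idP/idP => /set_mem H; apply/mem_set.
  case: H => _ sx; split => //; last exact: zero_on_upds.
  apply: contrapT => Kx; move: sx; rewrite (vol_notin _ dK)//.
    by rewrite lee_fin leNgt s0.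
  move=> i iY; apply: zero_on_upds; rewrite inE; apply: contraL iY.
  by rewrite mem_enum; exact: XY.
by case: H => _ _ sx; split.
Qed.

(** [vol_BM] over [X], applied to a slice and to the whole section of [K], with radii r v and v for
    v = V^(1/|X|); by [slice_comb] their combinations lie in the slice of height (1 - l)^|Y| s. *)
Lemma lifted_concave_levels (V : R) : (0 < #|X|)%N -> (0 < #|Y|)%N -> 0 < V ->
  vol (enum X) K origin = V%:E ->
  concave_levels P V #|X| #|Y| (lifted (vol (enum Y) K)).
Proof.
move=> X0 Y0 V0 VE; have [mK Kb Kd] := dK.
split.
- move=> s s0; rewrite distrib_lifted// -VE.
  have [ms _ _] := slice_downset s.
  apply: Iops_le; [exact: measurable_ind|exact: ind_ge0|exact: measurable_ind|exact: ind_ge0|].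
  move=> z w zw zx; have -> : z = w.
    by apply: eq_from_tnth => i; have [/zw//|/zx[-> ->]//] := boolP (i \in enum X).
  have [Kw|Kw] := pselect (K w); last by rewrite !ind0// => -[].
  by rewrite (ind1 Kw) lee_fin indicE; case: (_ \in _).
- have [C [C0 hC]] := vol_bounded cm dK (enum_uniq (mem Y)).
  by exists C => t; exact: hC.
move=> r l s r0 l01 s0; have /andP[l0 l1] := l01.
have q0 : 0 < (1 - l) ^+ #|Y| * s by rewrite mulr_gt0// exprn_gt0// subr_gt0.
rewrite !distrib_lifted// => Vr.
(* A slice of positive volume is nonempty, hence contains the origin, as [vol_BM] requires. *)
have os : slice s origin.
  apply: contrapT => os; move: Vr; rewrite (vol_notin _ (slice_downset s))//.
    by rewrite lee_fin leNgt mulr_gt0// exprn_gt0.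
  by move=> i _; rewrite tnth_origin.
have oo : comb l origin origin = origin :> T.
  by apply: eq_from_tnth => i; rewrite tnth_comb !tnth_origin !mulr0 addr0.
have KX : bounded_downset M [set x | K x /\ zero_on [predC X] x].
  split.
  - by apply: measurableI => //; exact: measurable_zero_on.
  - by move=> x i [Kx _]; exact: Kb.
  - move=> x y [Kx xX] yx; split; first exact: Kd Kx yx.
    move=> i iX; apply/le_anti; have /andP[-> yi] := yx i.
    by rewrite (le_trans yi)// xX.
have VX : vol (enum X) [set x | K x /\ zero_on [predC X] x] origin = V%:E.
  rewrite -VE; have [mKX _ _] := KX.
  apply: eq_Iops; [exact: measurable_ind|exact: ind_ge0|exact: measurable_ind|exact: ind_ge0|].
  move=> z zx; have zX : zero_on [predC X] z.
    by move=> i iX; rewrite zx ?tnth_origin// mem_enum.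
  have [Kz|Kz] := pselect (K z); first by rewrite !ind1.
  by rewrite !ind0// => -[].
pose v := V `^ (#|X|%:R^-1).
have vE : v ^+ #|X| = V by rewrite powRinvK// ltW.
have := vol_BM cm (enum_uniq (mem X)) l01 (slice_downset s) KX
  (slice_downset ((1 - l) ^+ #|Y| * s))
  (fun x y sx Ky => slice_comb Y0 l01 s0 (lexx _) sx Ky.1 Ky.2)
  os (conj K0 (fun i _ => tnth_origin i))
  (fun i _ => tnth_origin i) (fun i _ => tnth_origin i)
  (mulr_ge0 (powR_ge0 V (#|X|%:R^-1)) (ltW r0)) (powR_ge0 V (#|X|%:R^-1)).
rewrite -cardE oo -/v VX exprMn vE => /(_ Vr (lexx _)).
rewrite (_ : _ + _ = v * ((1 - l) * r + l)); last by ring.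
by rewrite exprMn vE.
Qed.

End Levels.

End KeyInequality.

Section LoomisWhitney.
Context {R : realType} {n : nat}.
Local Notation RB := (measurableTypeR R).
Local Notation T := (n.-tuple RB).
Variable m : 'I_n -> {sigma_finite_measure set RB -> \bar R}.
Hypothesis cm : forall k, concave_distribution (m k).
Variables (M : R) (K : set T).
Hypothesis dK : bounded_downset M K.
Hypothesis convK : forall l x y, 0 < l < 1 -> K x -> K y -> K (comb l x y).
Hypothesis K0 : K origin.

Definition setvol (S : {set 'I_n}) : \bar R := vol m (enum S) K origin.

Let mK : measurable_fun setT (ind K).
Proof. by have [mK _ _] := dK; exact: measurable_ind. Qed.

Lemma setvol_seq (S : {set 'I_n}) s : uniq s -> s =i S -> setvol S = vol m s K origin.
Proof.
move=> us sS; rewrite /setvol /vol (@perm_Iops _ _ _ _ s) ?enum_uniq//.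
  by apply: uniq_perm; rewrite ?enum_uniq// => i; rewrite mem_enum sS.
exact: ind_ge0.
Qed.

Lemma setvol_ge0 S : (0 <= setvol S)%E.
Proof. exact: (vol_ge0 _ dK). Qed.

Lemma setvol_lty S : (setvol S < +oo)%E.
Proof. by apply: (vol_lty cm dK); exact: enum_uniq. Qed.

Lemma setvol0 : setvol finset.set0 = 1%E.
Proof.
by rewrite (@setvol_seq _ [::])// ?/vol/= ?ind1// => i; rewrite finset.in_set0.
Qed.

Lemma setvolU (X Y : {set 'I_n}) : (forall i, i \in X -> i \notin Y) ->
  setvol (X :|: Y) = Iops m (enum X) (vol m (enum Y) K) origin.
Proof.
move=> XY; rewrite (@setvol_seq _ (enum X ++ enum Y)) /vol ?Iops_cat//.
  rewrite cat_uniq !enum_uniq andbT/=; apply/hasPn => i; rewrite !mem_enum => iY.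
  by apply: contraL iY; exact: XY.
by move=> i; rewrite mem_cat !mem_enum finset.in_setU.
Qed.

Lemma setvol_le_Iops (X Y Z : {set 'I_n}) :
  (forall i, i \in X -> i \notin Y) -> (forall i, i \in X -> i \notin Z) ->
  (forall i, i \in Y -> i \notin Z) ->
  (setvol (X :|: Y :|: Z) <= Iops m (enum X)
    (fun z => vol m (enum Y) K z * vol m (enum Z) K z) origin)%E.
Proof.
move=> XY XZ YZ.
have YX i : i \in Y -> i \notin X by move=> iY; apply: contraL iY; exact: XY.
have ZX i : i \in Z -> i \notin X by move=> iZ; apply: contraL iZ; exact: XZ.
have ZY i : i \in Z -> i \notin Y by move=> iZ; apply: contraL iZ; exact: YZ.
rewrite (@setvol_seq _ (enum X ++ (enum Y ++ enum Z))); first last.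
- by move=> i; rewrite !mem_cat !mem_enum !finset.in_setU orbA.
- rewrite !cat_uniq !enum_uniq/= !andbT; apply/andP; split.
    apply/hasPn => i; rewrite mem_cat !mem_enum => /orP[/YX|/ZX]//.
  by apply/hasPn => i; rewrite !mem_enum => /ZY.
rewrite {1}/vol Iops_cat -/(vol m (enum Y ++ enum Z) K).
apply: Iops_le.
- exact: (measurable_vol _ dK).
- exact: (vol_ge0 _ dK).
- by apply: emeasurable_funM; exact: (measurable_vol _ dK).
- by move=> x; rewrite mule_ge0// (vol_ge0 _ dK).
move=> x y xy xyz; have -> : x = y.
  by apply: eq_from_tnth => i; have [/xy//|/xyz[-> ->]//] := boolP (i \in enum X).
have yYZ : zero_on (mem (enum Y ++ enum Z)) y.
  move=> i; rewrite mem_cat !mem_enum => iYZ.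
  have /xyz[_ ->] : i \notin enum X; last by rewrite tnth_origin.
  by rewrite mem_enum; case/orP: iYZ => [/YX|/ZX].
have [Ky|Ky] := pselect (K y); last first.
  by rewrite (vol_notin _ dK)// mule_ge0// (vol_ge0 _ dK).
apply: (vol_cat_le m dK yYZ).
  by move=> i; rewrite !mem_enum; exact: YZ.
by move=> i; have [_ Kb _] := dK; have /andP[] := Kb _ i Ky.
Qed.

(* After fibering over [X], the fibre volumes over [Y] and [Z] are powers of
   concave functions, to which Berwald's inequality applies. *)
Lemma restricted_loomis_whitney (X Y Z : {set 'I_n}) :
  (forall i, i \in X -> i \notin Y) -> (forall i, i \in X -> i \notin Z) ->
  (forall i, i \in Y -> i \notin Z) ->
  (setvol (X :|: Y :|: Z) * setvol X <=
   (berwald_const #|X| #|Y| #|Z|)%:E * (setvol (X :|: Y) * setvol (X :|: Z)))%E.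
Proof.
move=> XY XZ YZ.
have fn0 p : p`!%:R != 0 :> R by rewrite pnatr_eq0 -lt0n fact_gt0.
(* Berwald's inequality needs positive dimensions. If one of the sets is empty the constant is 1:
   for [Y] or [Z] the claim is then an equality, and for [X] it is the product bound alone. *)
have [Y0|Y0] := posnP #|Y|.
  have -> : berwald_const #|X| #|Y| #|Z| = 1 :> R.
    by rewrite /berwald_const Y0 !addn0 add0n fact0 !natrM; field; rewrite !fn0.
  move/eqP: Y0; rewrite cards_eq0 => /eqP ->.
  by rewrite finset.setU0 mul1e muleC.
have [Z0|Z0] := posnP #|Z|.
  have -> : berwald_const #|X| #|Y| #|Z| = 1 :> R.
    by rewrite /berwald_const Z0 !addn0 fact0 !natrM; field; rewrite !fn0.
  move/eqP: Z0; rewrite cards_eq0 => /eqP ->.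
  by rewrite !finset.setU0 mul1e.
have le1 := setvol_le_Iops XY XZ YZ.
have [X0|X0] := posnP #|X|.
  have -> : berwald_const #|X| #|Y| #|Z| = 1 :> R.
    by rewrite /berwald_const X0 !add0n fact0 !natrM; field; rewrite !fn0.
  move/eqP: X0 le1; rewrite cards_eq0 => /eqP -> le1.
  rewrite setvol0 mule1 mul1e (le_trans le1)// !finset.set0U.
  by rewrite (_ : enum _ = [::])//; apply: size0nil; rewrite -cardE cards0.
have [V VE] : exists V, setvol X = V%:E.
  by exists (fine (setvol X)); rewrite fineK// ge0_fin_numE ?setvol_ge0 ?setvol_lty.
have : (0 <= setvol X)%E := setvol_ge0 X.
rewrite VE lee_fin le_eqVlt => /predU1P[<-|V0].
  rewrite mule0 !mule_ge0 ?setvol_ge0// lee_fin.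
  by rewrite divr_ge0.
have [P [_ PI]] := prod_measure_integral m (fun j : 'I_#|X| => enum_val j).
have mv s : measurable_fun setT (vol m s K) by exact: (measurable_vol _ dK).
have v0 s x : (0 <= vol m s K x)%E by exact: (vol_ge0 _ dK).
have bw := @berwald R _ _ P V #|X| V0 X0 #|Y| #|Z|
  (lifted (vol m (enum Y) K)) (lifted (vol m (enum Z) K)) Y0 Z0
  (measurable_lifted (mv _)) (fun t => v0 _ _)
  (lifted_concave_levels cm dK convK K0 XY PI X0 Y0 V0 VE)
  (measurable_lifted (mv _)) (fun t => v0 _ _)
  (lifted_concave_levels cm dK convK K0 XZ PI X0 Z0 V0 VE).
move: bw; rewrite !(integral_lifted PI)// -!setvolU//.
rewrite (_ : \int[P]_x _ = \int[P]_t (lifted (fun z => vol m (enum Y) K z * vol m (enum Z) K z) t))%E//.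
rewrite (integral_lifted PI); last 2 first.
- exact: emeasurable_funM.
- by move=> x; rewrite mule_ge0.
apply: le_trans; apply: lee_wpmul2r => //.
by rewrite lee_fin ltW.
Qed.

End LoomisWhitney.

(** * Decomposition of the difference body into orthants *)

Section OneCoordinateSplit.
Context {R : realType}.
Local Notation RB := (measurableTypeR R).
Variable m : {sigma_finite_measure set RB -> \bar R}.
Hypothesis atomless : forall c : R, m [set c] = 0%E.
Hypothesis sym : forall S : set RB, measurable S -> m ((-%R : R -> R) @^-1` S) = m S.

Let mopp : measurable_fun (setT : set RB) (-%R : RB -> RB).
Proof. exact: oppr_measurable. Qed.

Lemma integral_opp_sym (g : RB -> \bar R) : measurable_fun setT g ->
  (forall t, 0 <= g t)%E -> (\int[m]_t g (- t)%R = \int[m]_t g t)%E.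
Proof.
move=> mg g0.
transitivity (\int[pushforward m (-%R : RB -> RB)]_t g t)%E.
  by rewrite ge0_integral_pushforward// preimage_setT.
apply: eq_measure_integral => A mA _; exact: sym.
Qed.

(** For each sign of t one of the two factors is evaluated at 0; the reflection symmetry turns the
    negative half into an integral of [g]. Only at t = 0, a null set, do both contributions meet. *)
Lemma integral_split_sign (f g : RB -> \bar R) :
  measurable_fun setT f -> measurable_fun setT g ->
  (forall t, 0 <= f t)%E -> (forall t, 0 <= g t)%E ->
  (forall t, t < 0 -> f t = 0%E) -> (forall t, t < 0 -> g t = 0%E) ->
  (\int[m]_t (f (Num.max t 0)%R * g (Num.max (- t) 0)%R) =
   g 0%R * \int[m]_t f t + f 0%R * \int[m]_t g t)%E.
Proof.
move=> mf mg f0 g0 fn gn.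
have mgN : measurable_fun setT (fun t : RB => g (- t)) by exact: (measurableT_comp mg mopp).
have mmax : measurable_fun (setT : set RB) (fun t : RB => Num.max t 0 : RB).
  by apply: measurable_maxr => //; exact: measurable_id.
rewrite -(integral_opp_sym mg g0) -!ge0_integralZl// -ge0_integralD//; last 4 first.
- by move=> t _; rewrite mule_ge0.
- exact: measurable_funeM.
- by move=> t _; rewrite mule_ge0.
- exact: measurable_funeM.
apply: ge0_ae_eq_integral => //.
- apply: emeasurable_funM; first exact: (measurableT_comp mf mmax).
  exact: (measurableT_comp (measurableT_comp mg mmax) mopp).
- by apply: emeasurable_funD; exact: measurable_funeM.
- by move=> t _; rewrite mule_ge0.
- by move=> t _; rewrite adde_ge0// mule_ge0.
exists [set 0]; split; [exact: measurable_set1|exact: atomless|].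
move=> t /= H; apply: contrapT => t0; apply: H => _.
have [tn|tp|te] := ltgtP t 0; last by [].
  rewrite max_l; last by rewrite oppr_ge0 ltW.
  by rewrite (fn t)// mule0 add0e.
rewrite max_r; last by rewrite oppr_le0 ltW.
by rewrite (gn (- t)) ?oppr_lt0// mule0 adde0 muleC.
Qed.

End OneCoordinateSplit.

Section Splits.
Context {U : Type}.

(** The pairs of complementary subsets of the overview, as lists, so that the recursion follows the
    order of integration. *)
Fixpoint splits (s : seq U) : seq (seq U * seq U) :=
  if s is k :: s' then
    [seq (k :: p.1, p.2) | p <- splits s'] ++ [seq (p.1, k :: p.2) | p <- splits s']
  else [:: ([::], [::])].

Context {R : realType}.
Local Open Scope ereal_scope.

Lemma big_splits_cons (k : U) s (a : seq U * seq U -> \bar R) :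
  \sum_(p <- splits (k :: s)) a p =
  \sum_(p <- splits s) (a (k :: p.1, p.2)) + \sum_(p <- splits s) (a (p.1, k :: p.2)).
Proof. by rewrite /= big_cat !big_map. Qed.

Lemma le_sum_splits_cat_left c s (a : seq U * seq U -> \bar R) : (forall p, 0 <= a p) ->
  \sum_(p <- splits s) a (c ++ p.1, p.2) <= \sum_(p <- splits (c ++ s)) a p.
Proof.
elim: c a => [|k c IH] a a0.
  by rewrite le_eqVlt; apply/orP; left; apply/eqP; apply: eq_bigr => -[].
rewrite cat_cons big_splits_cons -[leLHS]adde0; apply: leeD.
  exact: (IH (fun p => a (k :: p.1, p.2))).
by apply: sume_ge0.
Qed.

Lemma le_sum_splits_cat_right c s (a : seq U * seq U -> \bar R) : (forall p, 0 <= a p) ->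
  \sum_(p <- splits s) a (p.1, c ++ p.2) <= \sum_(p <- splits (c ++ s)) a p.
Proof.
elim: c a => [|k c IH] a a0.
  by rewrite le_eqVlt; apply/orP; left; apply/eqP; apply: eq_bigr => -[].
rewrite cat_cons big_splits_cons -[leLHS]add0e; apply: leeD.
  by apply: sume_ge0.
exact: (IH (fun p => a (p.1, k :: p.2))).
Qed.

(** All of [c] on the left and all of it on the right are different splits because [c] is nonempty:
    its head lies on opposite sides. This is where properness of the subspace enters. *)
Lemma le_sum_splits_cat c s (a : seq U * seq U -> \bar R) : (0 < size c)%N ->
  (forall p, 0 <= a p) ->
  \sum_(p <- splits s) a (c ++ p.1, p.2) + \sum_(p <- splits s) a (p.1, c ++ p.2)
  <= \sum_(p <- splits (c ++ s)) a p.
Proof.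
case: c => // k c _ a0; rewrite cat_cons big_splits_cons; apply: leeD.
  exact: (le_sum_splits_cat_left c s (a := fun p => a (k :: p.1, p.2))).
exact: (le_sum_splits_cat_right c s (a := fun p => a (p.1, k :: p.2))).
Qed.

End Splits.

Lemma splits_perm (U : eqType) (s : seq U) p : p \in splits s ->
  perm_eq (p.1 ++ p.2) s.
Proof.
elim: s p => [|k s IH] p /=; first by rewrite inE => /eqP ->.
rewrite mem_cat => /orP[] /mapP[q /IH qs ->] /=; first by rewrite perm_cons.
by rewrite -cat1s perm_catCA/= perm_cons.
Qed.

Section SignDecomposition.
Context {R : realType} {n : nat}.
Local Notation RB := (measurableTypeR R).
Local Notation T := (n.-tuple RB).
Variable m : 'I_n -> {sigma_finite_measure set RB -> \bar R}.
Hypothesis cm : forall k, concave_distribution (m k).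
Hypothesis sym : forall k (S : set RB), measurable S ->
  m k ((-%R : R -> R) @^-1` S) = m k S.

Definition pos_part (x : T) : T := [tuple Num.max (tnth x i) 0 | i < n].
Definition neg_part (x : T) : T := [tuple Num.max (- tnth x i) 0 | i < n].

Lemma measurable_pos_part : measurable_fun setT pos_part.
Proof.
apply/measurable_fun_tnthP => i.
rewrite (_ : _ \o _ = fun x : T => Num.max (tnth x i) 0); last first.
  by apply/funext => x /=; rewrite tnth_mktuple.
by apply: measurable_maxr => //; exact: measurable_tnth.
Qed.

Lemma measurable_neg_part : measurable_fun setT neg_part.
Proof.
apply/measurable_fun_tnthP => i.
rewrite (_ : _ \o _ = fun x : T => Num.max (- tnth x i) 0); last first.
  by apply/funext => x /=; rewrite tnth_mktuple.
apply: measurable_maxr => //.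
exact: (measurableT_comp (@oppr_measurable R setT) (measurable_tnth i)).
Qed.

Lemma pos_part_upd x k t : pos_part (upd x k t) = upd (pos_part x) k (Num.max t 0).
Proof.
by apply: eq_from_tnth => i; rewrite !(tnth_upd, tnth_mktuple); case: eqP.
Qed.

Lemma neg_part_upd x k t : neg_part (upd x k t) = upd (neg_part x) k (Num.max (- t) 0).
Proof.
by apply: eq_from_tnth => i; rewrite !(tnth_upd, tnth_mktuple); case: eqP.
Qed.

Lemma upd_id (x : T) k : upd x k (tnth x k) = x.
Proof. by apply: eq_from_tnth => i; rewrite tnth_upd; case: eqP => // ->. Qed.

Variables (M : R) (A B : set T).
Hypotheses (dA : bounded_downset M A) (dB : bounded_downset M B).

Definition diff_body : set T := [set x | A (pos_part x) /\ B (neg_part x)].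

Lemma measurable_diff_body : measurable diff_body.
Proof.
have [[mA _ _] [mB _ _]] := (dA, dB).
apply: measurableI; rewrite -[X in measurable X]setTI.
  exact: measurable_pos_part.
exact: measurable_neg_part.
Qed.

(** Integrating one more coordinate splits each product by sign: the positive half assigns the
    coordinate to [A], the negative half to [B]. The base point is arbitrary outside [s] for the
    sake of the induction. *)
Lemma vol_diff_body s x : uniq s -> zero_on (mem s) x ->
  vol m s diff_body x =
  (\sum_(p <- splits s) (vol m p.1 A (pos_part x) * vol m p.2 B (neg_part x)))%E.
Proof.
elim: s x => [|k s IH] x.
  move=> _ _; rewrite /= big_seq1/= /vol/= /ind !indicE.
  have [Ax|Ax] := pselect (A (pos_part x)); last first.
    by rewrite (memNset Ax) mul0e memNset// => -[].
  have [Bx|Bx] := pselect (B (neg_part x)); last first.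
    by rewrite (memNset Bx) mule0 memNset// => -[].
  by rewrite !mem_set// mule1.
move=> /= /andP[ks us] xs.
have xk : tnth x k = 0 by apply: xs; rewrite mem_head.
have step t : vol m s diff_body (upd x k t) =
    (\sum_(p <- splits s) (vol m p.1 A (pos_part (upd x k t)) *
      vol m p.2 B (neg_part (upd x k t))))%E.
  apply: IH => // i si; rewrite tnth_upd; case: eqP => [ik|_].
    by move: ks; rewrite -ik si.
  by apply: xs; rewrite inE si orbT.
have mv D p y : bounded_downset M D -> measurable_fun setT (fun t : RB => vol m p D (upd y k t)).
  by move=> dD; apply: measurable_upd_fiber; exact: (measurable_vol _ dD).
pose f p t := vol m p A (upd (pos_part x) k t).
pose g p t := vol m p B (upd (neg_part x) k t).
have f0 p t : (0 <= f p t)%E by exact: (vol_ge0 _ dA).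
have g0 p t : (0 <= g p t)%E by exact: (vol_ge0 _ dB).
have mmax : measurable_fun (setT : set RB) (fun t : RB => Num.max t 0 : RB).
  by apply: measurable_maxr => //; exact: measurable_id.
have mmaxN : measurable_fun (setT : set RB) (fun t : RB => Num.max (- t) 0 : RB).
  by apply: (measurableT_comp mmax); exact: oppr_measurable.
transitivity (\int[m k]_t (\sum_(p <- splits s) (f p.1 (Num.max t 0)%R * g p.2 (Num.max (- t) 0)%R)))%E.
  apply: eq_integral => t _; rewrite [LHS]step.
  by apply: eq_bigr => p _; rewrite pos_part_upd neg_part_upd.
rewrite ge0_integral_sum//; last 2 first.
- move=> p; apply: emeasurable_funM.
    exact: (measurableT_comp (mv A p.1 (pos_part x) dA) mmax).
  exact: (measurableT_comp (mv B p.2 (neg_part x) dB) mmaxN).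
- by move=> p t _; rewrite mule_ge0.
rewrite big_splits_cons -big_split/=; apply: eq_big_seq => p ps.
have kp i : i \in p.1 ++ p.2 -> i != k.
  by rewrite (perm_mem (splits_perm ps)) => is_; apply: contraNneq ks => <-.
have k1 : k \notin p.1 by apply/negP => kp1; have := kp k; rewrite mem_cat kp1 eqxx => /(_ isT).
have k2 : k \notin p.2 by apply/negP => kp2; have := kp k; rewrite mem_cat kp2 orbT eqxx => /(_ isT).
have [_ atom _] := cm k.
rewrite (integral_split_sign atom (sym k))//; last 4 first.
- exact: mv.
- exact: mv.
- by move=> t t0; rewrite /f (vol_upd_out m dA _ k1)// negb_and -ltNge t0.
- by move=> t t0; rewrite /g (vol_upd_out m dB _ k2)// negb_and -ltNge t0.
have px : upd (pos_part x) k 0 = pos_part x.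
  by rewrite -[RHS](upd_id _ k) tnth_mktuple xk maxxx.
have nx : upd (neg_part x) k 0 = neg_part x.
  by rewrite -[RHS](upd_id _ k) tnth_mktuple xk oppr0 maxxx.
by rewrite /f /g px nx muleC.
Qed.

End SignDecomposition.

(** * Anti-blocking bodies *)

Section RowVectors.
Context {R : realType} {n : nat}.
Local Notation RB := (measurableTypeR R).
Local Notation T := (n.-tuple RB).
Local Notation row := (@row_of_tuple R n).

Let box (q : {ffun 'I_n -> rat}) (k : nat) : set T :=
  [set t | forall i, `|tnth t i - ratr (q i)| < k.+1%:R^-1].

Let measurable_box q k : measurable (box q k).
Proof.
rewrite (_ : box q k = \big[setI/setT]_i
    [set t : T | ratr (q i) - k.+1%:R^-1 < tnth t i < ratr (q i) + k.+1%:R^-1]).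
  apply: bigsetI_measurable => i _.
  have := @measurable_tnth _ RB n i measurableT
    `]ratr (q i) - k.+1%:R^-1, ratr (q i) + k.+1%:R^-1[%classic (measurable_itv _).
  rewrite setTI (_ : _ @^-1` _ = [set t : T | ratr (q i) - k.+1%:R^-1 < tnth t i < ratr (q i) + k.+1%:R^-1])//.
apply/seteqP; split => [t H|t].
  apply: (big_ind (fun A : set T => A t)) => //= i _.
  by move: (H i); rewrite ltr_distl.
move=> + i; rewrite (bigD1 i)//= => -[+ _].
by rewrite /= ltr_distl.
Qed.

(** Open sets refer to the norm of row vectors, measurable sets to the product structure on tuples;
    an open set is the union of the countably many rational boxes inside it. *)
Lemma measurable_open_row (U : set 'rV[R]_n) : open U -> measurable (row @^-1` U).
Proof.
move=> oU.
pose F (N : nat) : set T :=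
  if unpickle N is Some (q, k) then
    if `[< box q k `<=` row @^-1` U >] then box q k else set0
  else set0.
rewrite (_ : _ @^-1` _ = \bigcup_N F N).
  apply: bigcup_measurable => N _; rewrite /F.
  by case: unpickle => // -[q k]; case: ifP.
apply/seteqP; split => [t Ut|t [N _]]; last first.
  by rewrite /F; case: unpickle => // -[q k]; case: ifPn => // /asboolP H /H.
have /nbhs_ballP[e /= e0 Ue] : nbhs (row t) U by exact: open_nbhs_nbhs.
pose k := Num.bound (2 / e).
have ke : 2 * k.+1%:R^-1 < e.
  rewrite ltr_pdivrMr// mulrC -ltr_pdivrMr//.
  have : 2 / e < k%:R by apply: archi_boundP; rewrite divr_ge0// ltW.
  by move=> /lt_trans; apply; rewrite ltr_nat.
have k0 : 0 < k.+1%:R^-1 :> R by rewrite invr_gt0.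
have qP (i : 'I_n) : exists q : rat, `|tnth t i - ratr q| < k.+1%:R^-1.
  have := @rat_in_itvoo R (tnth t i - k.+1%:R^-1) (tnth t i + k.+1%:R^-1).
  case; first by rewrite ltrD2l gtrN.
  by move=> q; rewrite in_itv/= -ltr_distlC => ?; exists q.
pose q : {ffun 'I_n -> rat} := [ffun i => projT1 (cid (qP i))].
have tq : box q k t by move=> i; rewrite ffunE; case: cid.
exists (pickle (q, k)) => //; rewrite /F pickleK.
rewrite asboolT// => u uq; apply: Ue; split => // i j.
rewrite /ball/= !mxE; have := uq j; have := tq j.
rewrite (_ : tnth t j - tnth u j = (tnth t j - ratr (q j)) - (tnth u j - ratr (q j))); last by ring.
move=> h1 h2; apply: le_lt_trans (ler_normB _ _) _; apply: lt_trans ke.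
by rewrite mulr_natl mulr2n ltrD.
Qed.

Lemma measurable_compact_row (K : set 'rV[R]_n) : compact K -> measurable (row @^-1` K).
Proof.
move=> cK; have oK : open (~` K).
  apply: closed_openC; apply: compact_closed cK; exact: norm_hausdorff.
have := measurableC (measurable_open_row oK).
by rewrite -preimage_setC setCK.
Qed.

Lemma compact_row_bounded (K : set 'rV[R]_n) : compact K ->
  exists M : R, forall x i, K x -> x 0 i <= M.
Proof.
move=> /compact_bounded[M [_ KM]]; exists (M + 1) => x i Kx.
have : `|x| <= M + 1 by apply: (KM (M + 1)) => //; rewrite ltrDl.
apply: le_trans; apply: (le_trans (ler_norm _)).
rewrite [leRHS]mx_normrE.
exact: (@le_bigmax _ _ _ 0 (fun ij : 'I_1 * 'I_n => `|x ij.1 ij.2|) (0, i)).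
Qed.

End RowVectors.

Section AntiBlockingBodies.
Context {R : realType} {n : nat}.
Local Notation RB := (measurableTypeR R).
Local Notation T := (n.-tuple RB).
Local Notation row := (@row_of_tuple R n).

Definition tuple_of_row (x : 'rV[R]_n) : T := [tuple x 0 i | i < n].

Lemma tuple_of_rowK x : row (tuple_of_row x) = x.
Proof. by apply/rowP => i; rewrite mxE tnth_mktuple. Qed.

Lemma coord_projE (I : {set 'I_n}) (x : 'rV[R]_n) i :
  coord_proj I x 0 i = if i \in I then x 0 i else 0.
Proof.
rewrite /coord_proj summxE; case: ifPn => iI.
  rewrite (bigD1 i)//= !mxE !eqxx mulr1 big1 ?addr0// => k /andP[_ ki].
  by rewrite !mxE [i == k]eq_sym (negbTE ki) andbF mulr0.
rewrite big1// => k kI; rewrite !mxE eqxx/=; case: eqP => [ik|]; last by rewrite mulr0.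
by move: iI; rewrite ik kI.
Qed.

Section OneBody.
Variable A : set 'rV[R]_n.
Hypothesis abA : anti_blocking A.
Local Notation body := (row @^-1` A).

Lemma anti_blocking_proj (I : {set 'I_n}) x : A x -> A (coord_proj I x).
Proof.
have [_ _ pA] := abA; move=> Ax.
have : (coord_proj I @` A) (coord_proj I x) by exists x.
by rewrite pA => -[].
Qed.

Lemma anti_blocking_comb l x y : 0 < l < 1 -> body x -> body y -> body (comb l x y).
Proof.
move=> /andP[l0 l1] Ax Ay; have [[_ _ cA] _ _] := abA.
have := cA (row y) (row x) (Itv01 (ltW l0) (ltW l1)) (mem_set Ay) (mem_set Ax).
move=> /set_mem; congr (A _); apply/rowP => i.
by rewrite !mxE tnth_comb addrC.
Qed.

(** The projection that kills coordinate [k] gives the value 0, and intermediate values lie on the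
    segment from there to [x]. *)
Lemma anti_blocking_upd x k v : body x -> 0 <= v <= tnth x k -> body (upd x k v).
Proof.
move=> Ax /andP[v0 vx].
have A0 : body (upd x k 0).
  have := anti_blocking_proj [set~ k] Ax; congr (A _); apply/rowP => i.
  by rewrite coord_projE !mxE tnth_upd finset.in_setC1; case: eqP.
move: v0; rewrite le_eqVlt => /predU1P[<-//|v0].
move: vx; rewrite le_eqVlt => /predU1P[->|vx]; first by rewrite upd_id.
have x0 : 0 < tnth x k by exact: lt_trans vx.
rewrite (_ : upd x k v = comb (v / tnth x k) (upd x k 0) x).
  by apply: anti_blocking_comb => //; rewrite divr_gt0//= ltr_pdivrMr// mul1r.
apply: eq_from_tnth => i; rewrite tnth_comb !tnth_upd; case: eqP => [->|_].
  by rewrite mulr0 add0r divfK// gt_eqF.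
by rewrite -mulrDl subrK mul1r.
Qed.

Lemma anti_blocking_down x y : body x -> (forall i, 0 <= tnth y i <= tnth x i) -> body y.
Proof.
move=> Ax yx.
pose z (s : seq 'I_n) : T := [tuple if i \in s then tnth y i else tnth x i | i < n].
have Az s : body (z s).
  elim: s => [|k s IH].
    by rewrite (_ : z [::] = x)//; apply: eq_from_tnth => i; rewrite tnth_mktuple.
  rewrite (_ : z (k :: s) = upd (z s) k (tnth y k)).
    apply: anti_blocking_upd => //; have /andP[y0 yxk] := yx k.
    by rewrite y0 tnth_mktuple; case: ifP => //; rewrite lexx.
  apply: eq_from_tnth => i; rewrite tnth_upd !tnth_mktuple inE.
  by case: eqP => [->|].
rewrite (_ : y = z (enum 'I_n))//; apply: eq_from_tnth => i.
by rewrite tnth_mktuple mem_enum.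
Qed.

Lemma anti_blocking_downset : exists M0 : R, forall M, M0 <= M -> bounded_downset M body.
Proof.
have [[_ kA _] A0 _] := abA.
have [M0 AM] := compact_row_bounded kA.
exists M0 => M M0M; split; first exact: measurable_compact_row.
- move=> x i Ax; have := A0 _ Ax i; rewrite mxE => ->/=.
  by apply: le_trans M0M; have := AM _ i Ax; rewrite mxE.
- by move=> x y Ax yx; exact: anti_blocking_down yx.
Qed.

Lemma anti_blocking_origin : body origin.
Proof.
have [[[x Ax] _ _] A0 _] := abA.
apply: (@anti_blocking_down (tuple_of_row x)).
  by rewrite /preimage/= tuple_of_rowK.
by move=> i; rewrite tnth_origin lexx tnth_mktuple A0.
Qed.

End OneBody.

(** The positive part of a - b is dominated by a and the negative part by b, because both points are
    nonnegative. *)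
Lemma set_sub_diff_body (A B : set 'rV[R]_n) : anti_blocking A -> anti_blocking B ->
  row @^-1` (set_sub A B) = diff_body (row @^-1` A) (row @^-1` B).
Proof.
move=> abA abB; apply/seteqP; split => t /=; last first.
  move=> [At Bt]; exists (row (pos_part t)), (row (neg_part t)); split => //.
  apply/rowP => i; rewrite !mxE !tnth_mktuple.
  have [t0|t0] := leP 0 (tnth t i).
    by rewrite max_r ?oppr_le0// subr0.
  by rewrite max_l ?oppr_ge0 ?opprK ?add0r// ltW.
move=> [a [b [Aa Bb tab]]].
have [_ a0 _] := abA; have [_ b0 _] := abB.
have tE i : tnth t i = a 0 i - b 0 i.
  by have /rowP/(_ i) := tab; rewrite !mxE.
have {}a0 i : 0 <= a 0 i by exact: a0.
have {}b0 i : 0 <= b 0 i by exact: b0.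
split.
  apply: (anti_blocking_down abA (x := tuple_of_row a)).
    by rewrite /preimage/= tuple_of_rowK.
  move=> i; rewrite !tnth_mktuple le_max lexx orbT/= ge_max a0 andbT.
  by rewrite tE gerBl.
apply: (anti_blocking_down abB (x := tuple_of_row b)).
  by rewrite /preimage/= tuple_of_rowK.
move=> i; rewrite !tnth_mktuple le_max lexx orbT/= ge_max b0 andbT.
by rewrite tE opprB gerBl.
Qed.

End AntiBlockingBodies.

(** * Measures of bodies and of their projections *)

Section CoordinateMeasures.
Context {R : realType} {n : nat}.
Local Notation RB := (measurableTypeR R).
Local Notation T := (n.-tuple RB).
Local Notation row := (@row_of_tuple R n).
Variable m : 'I_n -> {sigma_finite_measure set RB -> \bar R}.

Lemma upds_enum (x t : T) : upds x (enum 'I_n) t = t.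
Proof.
apply: eq_from_tnth => i.
rewrite tnth_upds_in; last 3 first.
- exact: enum_uniq.
- by rewrite size_tuple size_enum_ord.
- by rewrite mem_enum.
by rewrite index_enum_ord (tnth_nth 0).
Qed.

Lemma subspace_pointE (I : {set 'I_n}) (t : #|I|.-tuple RB) :
  subspace_point t = row (upds origin [seq enum_val j | j <- enum 'I_#|I|] t) :> 'rV[R]_n.
Proof.
apply/rowP => i; rewrite mxE /subspace_point summxE.
have [iI|iI] := boolP (i \in I); last first.
  rewrite tnth_upds_notin ?map_enum_val ?mem_enum// tnth_origin big1// => j _.
  rewrite !mxE eqxx/=; case: eqP => [ij|]; last by rewrite mulr0.
  by move: iI; rewrite ij enum_valP.
have -> : i = enum_val (enum_rank_in iI i) by rewrite enum_rankK_in.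
move: (enum_rank_in iI i) => j; rewrite (bigD1 j)//= !mxE !eqxx mulr1 big1; last first.
  move=> k kj; rewrite !mxE (inj_eq enum_val_inj) eq_sym (negbTE kj).
  by rewrite andbF mulr0.
rewrite addr0 tnth_upds_in; last 3 first.
- by rewrite map_enum_val enum_uniq.
- by rewrite size_tuple size_map size_enum_ord.
- by apply/mapP; exists j => //; rewrite mem_enum.
by rewrite index_map ?index_enum_ord -?tnth_nth//; exact: enum_val_inj.
Qed.

Lemma space_measureE (S : set 'rV[R]_n) : measurable (row @^-1` S) ->
  space_measure m S = vol m (enum 'I_n) (row @^-1` S) origin.
Proof.
move=> mS; have [P [PE PI]] := prod_measure_integral m id.
rewrite /space_measure PE -[X in P X]setIT -[LHS]integral_indic//.
have := PI (ind (row @^-1` S)) origin (measurable_ind mS) (@ind_ge0 _ _ _).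
rewrite map_id /vol => <-; apply: eq_integral => t _.
by rewrite upds_enum.
Qed.

Lemma subspace_measureE (I : {set 'I_n}) (S : set 'rV[R]_n) :
  measurable (row @^-1` S) ->
  subspace_measure m I S = vol m (enum I) (row @^-1` S) origin.
Proof.
move=> mS; have [P [PE PI]] := prod_measure_integral m (fun j : 'I_#|I| => enum_val j).
rewrite /subspace_measure PE.
have mS' : measurable (@subspace_point R n I @^-1` S).
  have := measurable_upds_at (fun j : 'I_#|I| => enum_val j) (origin : T) measurableT mS.
  rewrite setTI; congr measurable; apply/seteqP; split => t /=;
  by rewrite subspace_pointE.
rewrite -[X in P X]setIT -[LHS]integral_indic//.
have := PI (ind (row @^-1` S)) origin (measurable_ind mS) (@ind_ge0 _ _ _).
rewrite /vol -map_enum_val => <-; apply: eq_integral => t _.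
rewrite /ind !indicE; congr ((nat_of_bool _)%:R%:E).
by apply/idP/idP => /set_mem H; apply/mem_set; move: H; rewrite /= subspace_pointE.
Qed.

(** The measure sees only the trace of [K] on the subspace. For a set stable under the projection,
    [K] can be the set itself, since its projection and its section coincide. *)
Lemma subspace_measure_proj (I : {set 'I_n}) (S : set 'rV[R]_n) (K : set T) :
  measurable K ->
  (forall x : T, zero_on [predC I] x -> (coord_proj I @` S) (row x) <-> K x) ->
  subspace_measure m I (coord_proj I @` S) = vol m (enum I) K origin.
Proof.
move=> mK SK.
have PE : row @^-1` (coord_proj I @` S) = K `&` [set x | zero_on [predC I] x].
  apply/seteqP; split => x /=.
    move=> Sx; have xI : zero_on [predC I] x.
      move=> i iI; have [y Sy /rowP/(_ i)] := Sx.
      by rewrite coord_projE mxE; move: iI; rewrite inE => /negbTE ->.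
    by split => //; exact/SK.
  by move=> [Kx xI]; exact/SK.
have mPS : measurable (row @^-1` (coord_proj I @` S)).
  by rewrite PE; apply: measurableI => //; exact: measurable_zero_on.
rewrite subspace_measureE// PE; apply: eq_Iops.
- by apply: measurable_ind; rewrite -PE.
- exact: ind_ge0.
- exact: measurable_ind.
- exact: ind_ge0.
move=> z zI; have zI' : zero_on [predC I] z.
  by move=> i iI; rewrite zI ?tnth_origin// mem_enum.
have [Kz|Kz] := pselect (K z); first by rewrite !ind1.
by rewrite !ind0// => -[].
Qed.

End CoordinateMeasures.

(** The constant is the term j = k + z of the maximum for n = k + y + z and i = k + y, where i + j -
    n = k. *)
Lemma berwald_const_le_rconst (R : realType) (k y z : nat) :
  berwald_const k y z <= rconst R (k + y + z) (k + y).
Proof.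
have jn : (k + z < (k + y + z).+1)%N by rewrite ltnS leq_add2r leq_addr.
have e : (k + y + (k + z) - (k + y + z) = k)%N.
  by rewrite [(k + z)%N]addnC addnA addKn.
rewrite /rconst.
apply: (@le_trans _ _ ('C(k + y, k)%:R * 'C(k + z, k)%:R / 'C(k + y + z, k)%:R)).
  rewrite le_eqVlt; apply/orP; left; apply/eqP.
  have fn0 p : p`!%:R != 0 :> R by rewrite pnatr_eq0 -lt0n fact_gt0.
  have bE a : 'C(k + a, k)%:R = (k + a)`!%:R / (k`!%:R * a`!%:R) :> R.
    have := bin_fact (leq_addr a k); rewrite addKn => <-.
    by rewrite !natrM mulfK// mulf_neq0.
  rewrite -addnA !bE /berwald_const !natrM !addnA; field.
  by rewrite !fn0.
have := @le_bigmax_cond _ R _ 0 (Ordinal jn)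
  (fun j : 'I_(k + y + z).+1 => (k + y + z <= k + y + j)%N)
  (fun j => 'C(k + y, k + y + j - (k + y + z))%:R * 'C(j, k + y + j - (k + y + z))%:R /
    'C(k + y + z, k + y + j - (k + y + z))%:R).
by rewrite /= e; apply; rewrite leq_add2l leq_addl.
Qed.

(** * The inequality for the difference body *)

Section DifferenceBody.
Context {R : realType} {n : nat}.
Local Notation RB := (measurableTypeR R).
Local Notation T := (n.-tuple RB).
Variable m : 'I_n -> {sigma_finite_measure set RB -> \bar R}.
Hypothesis cm : forall k, concave_distribution (m k).
Hypothesis sym : forall k (S : set RB), measurable S ->
  m k ((-%R : R -> R) @^-1` S) = m k S.
Variables (M : R) (I : {set 'I_n}).
Local Notation r := (rconst R n #|I|).
Local Notation sI := (enum I).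
Local Notation sC := (enum (~: I)).

Lemma rconst_ge0 : 0 <= r.
Proof. exact: bigmax_ge_id. Qed.

Section OneBody.
Variable K : set T.
Hypothesis dK : bounded_downset M K.
Hypothesis convK : forall l x y, 0 < l < 1 -> K x -> K y -> K (comb l x y).
Hypothesis K0 : K origin.

(** [restricted_loomis_whitney] with X = p1, Y = p2 and Z the complement of [I]. *)
Lemma vol_split_le (p1 p2 : seq 'I_n) : perm_eq (p1 ++ p2) sI ->
  (setvol m K [set: 'I_n]%SET * vol m p1 K origin <=
   r%:E * (setvol m K I * vol m (sC ++ p1) K origin))%E.
Proof.
move=> pI.
have : uniq (p1 ++ p2) by rewrite (perm_uniq pI) enum_uniq.
rewrite cat_uniq => /and3P[u1 /hasPn d12 u2].
have memI i : (i \in p1) || (i \in p2) = (i \in I).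
  by rewrite -mem_cat (perm_mem pI) mem_enum.
pose X := [set i in p1]%SET; pose Y := [set i in p2]%SET.
have XI : (X :|: Y = I)%SET.
  by apply/setP => i; rewrite finset.in_setU !finset.inE memI.
have cX : #|X| = size p1 by rewrite cardsE; apply/card_uniqP.
have cY : #|Y| = size p2 by rewrite cardsE; apply/card_uniqP.
have XY i : i \in X -> i \notin Y.
  by rewrite !finset.inE => i1; apply/negP => /d12; rewrite /= i1.
have XC i : i \in X -> i \notin (~: I)%SET.
  by rewrite !finset.inE negbK -memI => ->.
have YC i : i \in Y -> i \notin (~: I)%SET.
  by rewrite !finset.inE negbK -memI orbC => ->.
have := restricted_loomis_whitney cm dK convK K0 XY XC YC.
rewrite XI finset.setUCr.
rewrite (setvol_seq m dK (S := X) u1); last by move=> i; rewrite finset.inE.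
rewrite (setvol_seq m dK (S := (X :|: ~: I)%SET) (s := sC ++ p1)); first last.
- by move=> i; rewrite mem_cat mem_enum !finset.inE orbC.
- rewrite cat_uniq enum_uniq u1 andbT/=; apply/hasPn => i i1.
  by rewrite /= mem_enum; apply: XC; rewrite finset.inE.
move=> /le_trans; apply; apply: lee_wpmul2r.
  by rewrite mule_ge0// ?(setvol_ge0 m dK) ?(vol_ge0 m dK).
rewrite lee_fin.
have cI : #|I| = (#|X| + #|Y|)%N.
  by rewrite cX cY -size_cat (perm_size pI) -cardE.
have nE : n = (#|X| + #|Y| + #|~: I|)%N.
  by rewrite -cI -[LHS]card_ord -(cardsC I).
have := @berwald_const_le_rconst R #|X| #|Y| #|~: I|.
by rewrite -nE -cI.
Qed.

End OneBody.

Variables A B : set T.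
Hypotheses (dA : bounded_downset M A) (dB : bounded_downset M B).
Hypothesis convA : forall l x y, 0 < l < 1 -> A x -> A y -> A (comb l x y).
Hypothesis convB : forall l x y, 0 < l < 1 -> B x -> B y -> B (comb l x y).
Hypotheses (A0 : A origin) (B0 : B origin).
Hypothesis IT : (0 < #|~: I|)%N.
Local Notation D := (diff_body A B).

Let pos0 : pos_part origin = origin :> T.
Proof. by apply: eq_from_tnth => i; rewrite !tnth_mktuple maxxx. Qed.

Let neg0 : neg_part origin = origin :> T.
Proof. by apply: eq_from_tnth => i; rewrite !tnth_mktuple oppr0 maxxx. Qed.

Lemma vol_diff_origin s : uniq s -> vol m s D origin =
  (\sum_(p <- splits s) (vol m p.1 A origin * vol m p.2 B origin))%E.
Proof.
move=> us; rewrite (vol_diff_body cm sym dA dB us) ?pos0 ?neg0//.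
by move=> i _; rewrite tnth_origin.
Qed.

Lemma vol_le_diff s : (vol m s A origin <= vol m s D origin)%E.
Proof.
have [mA Ab _] := dA.
apply: Iops_le; [exact: measurable_ind|exact: ind_ge0| |exact: ind_ge0|].
  by apply: measurable_ind; exact: (measurable_diff_body dA dB).
move=> z w zw zo; have -> : z = w.
  by apply: eq_from_tnth => i; have [/zw//|/zo[-> ->]//] := boolP (i \in s).
have [Aw|Aw] := pselect (A w); last by rewrite ind0// ind_ge0.
rewrite !ind1//; split.
  rewrite (_ : pos_part w = w)//; apply: eq_from_tnth => i.
  by rewrite tnth_mktuple max_l//; case/andP: (Ab w i Aw).
rewrite (_ : neg_part w = origin)//; apply: eq_from_tnth => i.
by rewrite !tnth_mktuple max_r// oppr_le0; case/andP: (Ab w i Aw).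
Qed.

Let v0A s : (0 <= vol m s A origin)%E. Proof. exact: (vol_ge0 m dA). Qed.
Let v0B s : (0 <= vol m s B origin)%E. Proof. exact: (vol_ge0 m dB). Qed.

Lemma vol_diff_lty s : uniq s -> (vol m s D origin < +oo)%E.
Proof.
move=> us; rewrite vol_diff_origin// big_seq; apply: lte_sum_pinfty => p ps.
have : uniq (p.1 ++ p.2) by rewrite (perm_uniq (splits_perm ps)).
rewrite cat_uniq => /and3P[u1 _ u2].
by apply: lte_mul_pinfty; rewrite ?ge0_fin_numE ?(vol_lty cm dA) ?(vol_lty cm dB).
Qed.

(** The theorem with denominators cleared, so that sums of extended reals can be handled without
    division. *)
Lemma vol_diff_body_ineq :
  (setvol m A [set: 'I_n]%SET * (setvol m B I * vol m sI D origin) +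
   setvol m B [set: 'I_n]%SET * (setvol m A I * vol m sI D origin) <=
   r%:E * (setvol m A I * (setvol m B I * vol m (enum 'I_n) D origin)))%E.
Proof.
have a0 S : (0 <= setvol m A S)%E by exact: v0A.
have b0 S : (0 <= setvol m B S)%E by exact: v0B.
have r0 : (0 <= r%:E)%E by rewrite lee_fin rconst_ge0.
set a := setvol m A [set: 'I_n]%SET; set b := setvol m B [set: 'I_n]%SET.
set aI := setvol m A I; set bI := setvol m B I.
have aI0 : (0 <= aI)%E by exact: a0.
have bI0 : (0 <= bI)%E by exact: b0.
(* The summands of the volume of [D] in which all coordinates outside [I] go to [A]; in [S2] they go
   to [B]. *)
pose S1 := (\sum_(p <- splits sI) (vol m (sC ++ p.1) A origin * vol m p.2 B origin))%E.
pose S2 := (\sum_(p <- splits sI) (vol m p.1 A origin * vol m (sC ++ p.2) B origin))%E.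
have S10 : (0 <= S1)%E by apply: sume_ge0 => p _; rewrite mule_ge0.
have S20 : (0 <= S2)%E by apply: sume_ge0 => p _; rewrite mule_ge0.
have uI : uniq sI by exact: enum_uniq.
have le1 : (a * vol m sI D origin <= r%:E * (aI * S1))%E.
  rewrite vol_diff_origin// ge0_sume_distrr; last by move=> p _; rewrite mule_ge0.
  rewrite /S1 ge0_sume_distrr; last by move=> p _; rewrite mule_ge0.
  rewrite ge0_sume_distrr; last by move=> p _; do 2 apply: mule_ge0 => //.
  rewrite big_seq [leRHS]big_seq; apply: lee_sum => p ps.
  have h := vol_split_le dA convA A0 (splits_perm ps).
  rewrite [X in (_ <= X)%E](_ : _ = (r%:E * (aI * vol m (sC ++ p.1) A origin)) * vol m p.2 B origin)%E.
    by rewrite muleA; apply: lee_wpmul2r.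
  by rewrite -!muleA.
have le2 : (b * vol m sI D origin <= r%:E * (bI * S2))%E.
  rewrite vol_diff_origin// ge0_sume_distrr; last by move=> p _; rewrite mule_ge0.
  rewrite /S2 ge0_sume_distrr; last by move=> p _; rewrite mule_ge0.
  rewrite ge0_sume_distrr; last by move=> p _; do 2 apply: mule_ge0 => //.
  rewrite big_seq [leRHS]big_seq; apply: lee_sum => p ps.
  have p21 : perm_eq (p.2 ++ p.1) sI by rewrite perm_catC; exact: splits_perm.
  have h := vol_split_le dB convB B0 p21.
  rewrite [X in (_ <= X)%E](_ : _ = (r%:E * (bI * vol m (sC ++ p.2) B origin)) * vol m p.1 A origin)%E.
    by rewrite [X in (_ * X <= _)%E]muleC muleA; apply: lee_wpmul2r.
  by rewrite [X in (_ * (_ * X))%E]muleC -!muleA.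
have le3 : (S1 + S2 <= vol m (enum 'I_n) D origin)%E.
  have uC : uniq (sC ++ sI).
    rewrite cat_uniq !enum_uniq andbT/=; apply/hasPn => i.
    by rewrite /= !mem_enum finset.in_setC negbK.
  rewrite /vol (@perm_Iops _ _ _ _ (sC ++ sI)) ?enum_uniq//; last 3 first.
  - apply: uniq_perm; rewrite ?enum_uniq// => i.
    by rewrite mem_cat !mem_enum finset.in_setC orNb.
  - by apply: measurable_ind; exact: (measurable_diff_body dA dB).
  - exact: ind_ge0.
  rewrite -/(vol m (sC ++ sI) D) vol_diff_origin//.
  apply: (le_sum_splits_cat sI (a := fun p => (vol m p.1 A origin * vol m p.2 B origin)%E)).
    by rewrite -cardE.
  by move=> p; rewrite mule_ge0.
apply: (@le_trans _ _ (bI * (r%:E * (aI * S1)) + aI * (r%:E * (bI * S2)))%E).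
  rewrite muleCA [X in (_ + X <= _)%E]muleCA.
  by apply: leeD; apply: lee_wpmul2l.
have -> : (bI * (r%:E * (aI * S1)) + aI * (r%:E * (bI * S2)) =
    r%:E * (aI * (bI * (S1 + S2))))%E.
  rewrite !ge0_muleDr ?mule_ge0//; congr (_ + _)%E.
    by rewrite (muleCA bI) (muleCA bI).
  by rewrite (muleCA aI r%:E).
by do 3 (apply: lee_wpmul2l => //).
Qed.

End DifferenceBody.

Lemma dim_coord_subspace (R : realType) (n : nat) (I : {set 'I_n}) :
  \dim (@coord_subspace R n I) = #|I|.
Proof.
have sz : size [seq basis_vec (R := R) k | k <- enum I] = #|I|.
  by rewrite size_map -cardE.
rewrite -[RHS]sz; apply/eqP; rewrite -/(free _).
apply/freeP => c c0 j.
have jI : (j < size (enum I))%N by rewrite -cardE.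
have [k0 _] : exists k : 'I_n, True.
  by move: jI; case: (enum I) => // k s _; exists k.
have := congr1 (fun x : 'rV[R]_n => x 0 (nth k0 (enum I) j)) c0.
rewrite summxE mxE (bigD1 j)//= (nth_map k0)// !mxE !eqxx mulr1 big1 ?addr0//.
move=> l lj; have lI : (l < size (enum I))%N by rewrite -cardE.
rewrite !mxE (nth_map k0)// !mxE eqxx/= nth_uniq ?enum_uniq//.
by rewrite (_ : (nat_of_ord j == l) = false) ?mulr0//; apply/negbTE; rewrite eq_sym.
Qed.

Lemma proper_coord_subspace (R : realType) (n : nat) (I : {set 'I_n}) :
  @coord_subspace R n I != fullv -> (0 < #|~: I|)%N.
Proof.
apply: contraNT; rewrite -eqn0Ngt cards_eq0 => /eqP CI.
apply/eqP/vspaceP => x; rewrite memvf; apply/coord_subspaceP => k kI.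
have := congr1 (fun S : {set 'I_n} => k \in S) CI.
by rewrite /= finset.in_setC kI finset.in_set0.
Qed.

Theorem theorem26 (R : realType) (n : nat)
    (mu : 'I_n -> {measure set (measurableTypeR R) -> \bar R})
    (A B : set 'rV[R]_n) (I : {set 'I_n}) (i : nat) :
  (forall k, even_decreasing_density (mu k)) ->
  anti_blocking A -> anti_blocking B ->
  @coord_subspace R n I != fullv -> \dim (@coord_subspace R n I) = i ->
  (0 < subspace_measure mu I (coord_proj I @` A))%E ->
  (0 < subspace_measure mu I (coord_proj I @` B))%E ->
  (space_measure mu A / subspace_measure mu I (coord_proj I @` A) +
   space_measure mu B / subspace_measure mu I (coord_proj I @` B) <=
   (rconst R n i)%:E *
     (space_measure mu (set_sub A B) /
      subspace_measure mu I (coord_proj I @` set_sub A B)))%E.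
Proof.
move=> dmu abA abB /proper_coord_subspace IT.
rewrite dim_coord_subspace => <-.
have [m mE] : exists m : 'I_n -> {sigma_finite_measure set (measurableTypeR R) -> \bar R},
    forall k, mu k = m k :> (set _ -> _).
  have := fun k => cid (even_decreasing_sigma_finite (dmu k)).
  by move=> f; exists (fun k => projT1 (f k)) => k; exact: (projT2 (f k)).
have {}mE : (fun k => mu k : set (measurableTypeR R) -> \bar R) = (fun k => m k).
  by apply/funext => k; exact: mE.
have cm k : concave_distribution (m k).
  by rewrite -(congr1 (@^~ k) mE); exact: even_decreasing_concave.
have sym k (S : set (measurableTypeR R)) : measurable S ->
    m k ((-%R : R -> R) @^-1` S) = m k S.
  rewrite -(congr1 (@^~ k) mE); exact: even_decreasing_sym.
rewrite mE {mE dmu mu}.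
have [MA dA] := anti_blocking_downset abA; have [MB dB] := anti_blocking_downset abB.
pose M := Num.max MA MB.
have {}dA : bounded_downset M (@row_of_tuple R n @^-1` A).
  by apply: dA; rewrite le_max lexx.
have {}dB : bounded_downset M (@row_of_tuple R n @^-1` B).
  by apply: dB; rewrite le_max lexx orbT.
set KA := _ @^-1` A in dA *; set KB := _ @^-1` B in dB *.
have [[mA _ _] [mB _ _]] := (dA, dB).
have A0 : KA origin by exact: anti_blocking_origin.
have B0 : KB origin by exact: anti_blocking_origin.
have DE : @row_of_tuple R n @^-1` (set_sub A B) = diff_body KA KB.
  exact: set_sub_diff_body.
have mD := measurable_diff_body dA dB.
have projE (S : set 'rV[R]_n) (x : n.-tuple (measurableTypeR R)) :
    (forall y, S y -> S (coord_proj I y)) -> zero_on [predC I] x ->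
    (coord_proj I @` S) (row_of_tuple x) <-> (@row_of_tuple R n @^-1` S) x.
  move=> SP xI; split => [[y Sy yx]|Sx].
    by rewrite /preimage/= -yx; exact: SP.
  exists (row_of_tuple x) => //; apply/rowP => k; rewrite coord_projE.
  by case: ifPn => // kI; rewrite mxE xI.
have SD y : set_sub A B y -> set_sub A B (coord_proj I y).
  move=> [a [b [Aa Bb ->]]]; exists (coord_proj I a), (coord_proj I b).
  split; [exact: anti_blocking_proj|exact: anti_blocking_proj|].
  apply/rowP => k; rewrite !mxE !coord_projE !mxE.
  by case: ifP; rewrite ?subr0.
rewrite (subspace_measure_proj (S := A) (K := KA) m mA); last first.
  by move=> x; apply: projE; exact: anti_blocking_proj.
rewrite (subspace_measure_proj (S := B) (K := KB) m mB); last first.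
  by move=> x; apply: projE; exact: anti_blocking_proj.
rewrite (subspace_measure_proj (S := set_sub A B) (K := diff_body KA KB) m mD); last first.
  by move=> x; rewrite -DE; exact: projE.
rewrite !space_measureE// ?DE//.
have setvolT (K : set (n.-tuple (measurableTypeR R))) :
    vol m (enum 'I_n) K origin = setvol m K [set: 'I_n]%SET.
  rewrite /setvol; congr (vol m _ K origin).
  by apply: eq_enum => k; rewrite finset.in_setT.
have fA s : uniq s -> vol m s KA origin \is a fin_num.
  by move=> us; rewrite ge0_fin_numE ?(vol_lty cm dA) ?(vol_ge0 m dA).
have fB s : uniq s -> vol m s KB origin \is a fin_num.
  by move=> us; rewrite ge0_fin_numE ?(vol_lty cm dB) ?(vol_ge0 m dB).
have fD s : uniq s -> vol m s (diff_body KA KB) origin \is a fin_num.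
  move=> us; rewrite ge0_fin_numE ?(vol_diff_lty cm sym dA dB)//.
  by apply: Iops_ge0; [exact: measurable_ind|exact: ind_ge0].
move=> aI0 bI0.
(* The remaining denominator is positive because the difference body contains [A], as [B] contains
   the origin. *)
have E0 := lt_le_trans aI0 (vol_le_diff m dA dB B0 (enum I)).
have := vol_diff_body_ineq cm sym dA dB
  (anti_blocking_comb abA) (anti_blocking_comb abB) A0 B0 IT.
rewrite -!setvolT /setvol.
move: aI0 bI0 E0.
rewrite -(fineK (fA _ (enum_uniq (mem I)))) -(fineK (fB _ (enum_uniq (mem I)))).
rewrite -(fineK (fD _ (enum_uniq (mem I)))) -(fineK (fA _ (enum_uniq (mem 'I_n)))).
rewrite -(fineK (fB _ (enum_uniq (mem 'I_n)))) -(fineK (fD _ (enum_uniq (mem 'I_n)))).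
set aI := fine _; set bI := fine _; set E := fine _.
set a := fine _; set b := fine _; set D := fine _; set r := rconst _ _ _.
rewrite !lte_fin => aI0 bI0 E0.
rewrite !inver !gt_eqF// -!EFinM -!EFinD !lee_fin => H.
rewrite -(ler_pM2r (mulr_gt0 (mulr_gt0 aI0 bI0) E0)).
rewrite [X in X <= _](_ : _ = a * (bI * E) + b * (aI * E)); last first.
  by field; rewrite !gt_eqF.
rewrite [X in _ <= X](_ : _ = r * (aI * (bI * D)))//.
by field; rewrite gt_eqF.
Qed.
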